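(* (ZF) Suppose $U$ is a $\sigma$-complete ultrafilter on a set $X$. For every condition $p=(s^p,T^p)\in\mathbb{P}(U)$ and every $D\subseteq\mathbb{P}(U)$ which is dense open below $p$, there are a direct extension $q=(s^p,T^q)\le^* p$ and $n<\omega$ such that for every $t\in T^q$ of length $|t|\ge n$ there is a ($U$-large) sub-tree $R_t\subseteq T^q_t$ such that $(s^p{}^\frown t,R_t)$ is a direct extension of $q^\frown t:=(s^p{}^\frown t,T^q_t)$ and belongs to $D$. Moreover, the direct extension $q$ and the parameter $n$ are determined canonically from $p$ and $D$ (that is, there is a definable assignment, with $U$ as a parameter, $(p,D)\mapsto(q,n)$ with this property).
   Context: The base theory is ZF (no choice). $\sigma$-complete means closed under countable intersections. Tree Prikry forcing $\mathbb{P}(U)$ for an ultrafilter $U$ on $X$: conditions are pairs $p=(s^p,T^p)$ where $s^p\in X^{<\omega}$ and $T^p\subseteq X^{<\omega}$ is a $U$-large tree, i.e. a tree with $\langle\rangle\in T^p$ and $\mathrm{succ}_{T^p}(t)=\{x: t^\frown\langle x\rangle\in T^p\}\in U$ for every $t\in T^p$. For a tree $T$ and $r\in T$ let $T_r=\{t: r^\frown t\in T\}$. A condition $q$ is a direct extension of $p$, written $q\le^* p$, if $s^q=s^p$ and $T^q\subseteq T^p$; a one-point extension of $(s,T)$ is $(s^\frown\langle x\rangle,T_{\langle x\rangle})$ with $x\in\mathrm{succ}_T(\langle\rangle)$. A condition $q$ extends $p$ ($q\le p$) if it is obtained from $p$ by finitely many one-point extensions and direct extensions. *)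

(* Defs.v *)
(** The base theory is ZF, so the ambient type theory must not supply choice:
    set theory is modelled by an arbitrary first-order structure satisfying the
    axioms of ZF.  A statement is a theorem of ZF iff it holds in all such
    structures, provided its quantifiers over sets range over the structure.
    Accordingly all notions below, including natural numbers and finiteness,
    are internal to the structure, and no definition other than those of
    formulas, satisfaction and [ZF] refers to anything outside it. *)

Record set_structure : Type := {
  dom :> Type;
  mem : dom -> dom -> Prop
}.
Arguments mem {_} _ _.

Declare Scope sets_scope.
Delimit Scope sets_scope with sets.
Open Scope sets_scope.

Notation "x ∈ y" := (mem x y) (at level 70, no associativity) : sets_scope.

Definition subset {V : set_structure} (a b : V) : Prop := forall x, x ∈ a -> x ∈ b.
Notation "x ⊆ y" := (subset x y) (at level 70, no associativity) : sets_scope.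

(** Formulas of the language of set theory, with de Bruijn variables. *)
Inductive formula : Type :=
| f_mem : nat -> nat -> formula
| f_eq : nat -> nat -> formula
| f_false : formula
| f_and : formula -> formula -> formula
| f_or : formula -> formula -> formula
| f_imp : formula -> formula -> formula
| f_all : formula -> formula
| f_ex : formula -> formula.

Definition scons {A : Type} (a : A) (rho : nat -> A) : nat -> A :=
  fun i => match i with O => a | S j => rho j end.
Notation "a .: rho" := (scons a rho) (at level 55, right associativity) : sets_scope.

Fixpoint sat (V : set_structure) (rho : nat -> V) (phi : formula) : Prop :=
  match phi with
  | f_mem i j => rho i ∈ rho j
  | f_eq i j => rho i = rho j
  | f_false => False
  | f_and phi1 phi2 => sat V rho phi1 /\ sat V rho phi2
  | f_or phi1 phi2 => sat V rho phi1 \/ sat V rho phi2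
  | f_imp phi1 phi2 => sat V rho phi1 -> sat V rho phi2
  | f_all phi1 => forall a : V, sat V (a .: rho) phi1
  | f_ex phi1 => exists a : V, sat V (a .: rho) phi1
  end.

Section SetTheory.
Context {V : set_structure}.
Implicit Types a b c e f g i j k l m n p q r s t u w x y z : V.

Definition is_empty e : Prop := forall x, ~ x ∈ e.

Definition is_upair c a b : Prop := forall x, x ∈ c <-> x = a \/ x = b.

Definition is_pair p a b : Prop :=
  exists c d, is_upair c a a /\ is_upair d a b /\ is_upair p c d.

(** [b = a ∪ {a}] *)
Definition is_succ b a : Prop := forall x, x ∈ b <-> x ∈ a \/ x = a.

Definition inductive w : Prop :=
  (exists e, is_empty e /\ e ∈ w) /\
  (forall a, a ∈ w -> exists b, is_succ b a /\ b ∈ w).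

(** [n < ω] *)
Definition natural n : Prop := forall w, inductive w -> n ∈ w.

Definition is_omega w : Prop := forall n, n ∈ w <-> natural n.

(** [f(x) = y] *)
Definition app f x y : Prop := exists p, is_pair p x y /\ p ∈ f.

Definition function_on f a : Prop :=
  (forall p, p ∈ f -> exists x y, x ∈ a /\ is_pair p x y) /\
  (forall x, x ∈ a -> exists! y, app f x y).

Definition maps f a b : Prop :=
  function_on f a /\ forall x y, app f x y -> y ∈ b.

(** [s ∈ X^n], hence [|s| = n] *)
Definition seq (X s n : V) : Prop := natural n /\ maps s n X.

Definition finseq (X s : V) : Prop := exists n, seq X s n.

(** [g] is the function [i ↦ k + i] on [m + 1 = {0, ..., m}]. *)
Definition is_shift g k m : Prop :=
  (exists m', is_succ m' m /\ function_on g m') /\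
  (exists z, is_empty z /\ app g z k) /\
  (forall i i' j j', i ∈ m -> is_succ i' i -> app g i j -> is_succ j' j ->
    app g i' j').

(** [u = s⌢t] in [X^{<ω}]: if [|s| = k] and [|t| = m] then [|u| = k + m],
    [u(i) = s(i)] for [i < k] and [u(k + i) = t(i)] for [i < m]. *)
Definition is_cat (X s t u : V) : Prop :=
  exists k m l g,
    seq X s k /\ seq X t m /\ seq X u l /\ is_shift g k m /\ app g m l /\
    (forall i x, app s i x -> app u i x) /\
    (forall i j x, app t i x -> app g i j -> app u j x).

(** [t = ⟨x⟩ = {(0, x)}] *)
Definition is_single x t : Prop :=
  forall p, p ∈ t <-> exists z, is_empty z /\ is_pair p z x.

(** [u = t⌢⟨x⟩] *)
Definition is_snoc (X t x u : V) : Prop :=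
  exists sx, is_single x sx /\ is_cat X t sx u.

Definition ultrafilter (X U : V) : Prop :=
  (forall A, A ∈ U -> A ⊆ X) /\
  X ∈ U /\
  (forall A, A ∈ U -> ~ is_empty A) /\
  (forall A B, A ∈ U -> A ⊆ B -> B ⊆ X -> B ∈ U) /\
  (forall A B C, A ∈ U -> B ∈ U -> (forall x, x ∈ C <-> x ∈ A /\ x ∈ B) -> C ∈ U) /\
  (forall A B, A ⊆ X -> (forall x, x ∈ B <-> x ∈ X /\ ~ x ∈ A) -> A ∈ U \/ B ∈ U).

Definition sigma_complete (U : V) : Prop :=
  forall w f B, is_omega w -> maps f w U ->
    (forall x, x ∈ B <-> forall n A, app f n A -> x ∈ A) -> B ∈ U.

(** For finite sequences, [s] is an initial segment of [t] iff [s ⊆ t]. *)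
Definition tree (X T : V) : Prop :=
  (forall t, t ∈ T -> finseq X t) /\
  (forall s t, t ∈ T -> finseq X s -> s ⊆ t -> s ∈ T).

(** [A = succ_T(t)] *)
Definition is_tree_succ (X T t A : V) : Prop :=
  forall x, x ∈ A <-> x ∈ X /\ exists u, is_snoc X t x u /\ u ∈ T.

Definition large_tree (X U T : V) : Prop :=
  tree X T /\
  (exists e, is_empty e /\ e ∈ T) /\
  (forall t, t ∈ T -> exists A, is_tree_succ X T t A /\ A ∈ U).

(** [T' = T_r] *)
Definition is_subtree_at (X T r T' : V) : Prop :=
  forall t, t ∈ T' <-> exists u, is_cat X r t u /\ u ∈ T.

(** [p = (s, T)] is a condition of [P(U)]. *)
Definition is_cond (X U p s T : V) : Prop :=
  is_pair p s T /\ finseq X s /\ large_tree X U T.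

Definition condition (X U p : V) : Prop := exists s T, is_cond X U p s T.

(** [q ≤* p] *)
Definition direct_ext (X U q p : V) : Prop :=
  exists s Tq Tp, is_cond X U q s Tq /\ is_cond X U p s Tp /\ Tq ⊆ Tp.

Definition one_point_ext (X U q p : V) : Prop :=
  exists s T s' T' e A x sx,
    is_cond X U p s T /\ is_cond X U q s' T' /\
    is_empty e /\ is_tree_succ X T e A /\ x ∈ A /\
    is_snoc X s x s' /\ is_single x sx /\ is_subtree_at X T sx T'.

(** [q ≤ p]: there is a finite chain [p = f(0), ..., f(k) = q] whose steps are
    direct extensions or one-point extensions. *)
Definition extends (X U q p : V) : Prop :=
  condition X U p /\
  exists k k' f z,
    natural k /\ is_succ k' k /\ function_on f k' /\
    is_empty z /\ app f z p /\ app f k q /\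
    (forall i i' a b, i ∈ k -> is_succ i' i -> app f i a -> app f i' b ->
      direct_ext X U b a \/ one_point_ext X U b a).

(** Openness is only required below [p]. *)
Definition dense_open_below (X U p D : V) : Prop :=
  (forall q, q ∈ D -> condition X U q) /\
  (forall q, extends X U q p -> exists r, extends X U r q /\ r ∈ D) /\
  (forall q r, q ∈ D -> extends X U q p -> extends X U r q -> r ∈ D).

(** [|t| ≥ n] *)
Definition length_ge (X t n : V) : Prop :=
  exists m, seq X t m /\ (n = m \/ n ∈ m).

(** [q] is a direct extension of [p] and, for every [t ∈ T^q] with [|t| ≥ n],
    some direct extension of [q⌢t = (s⌢t, T^q_t)] belongs to [D]. *)
Definition decides_by (X U p D q n : V) : Prop :=
  natural n /\ direct_ext X U q p /\
  exists s Tq, is_pair q s Tq /\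
    forall t, t ∈ Tq -> length_ge X t n ->
      exists st Tqt qt R r,
        is_cat X s t st /\ is_subtree_at X Tq t Tqt /\ is_pair qt st Tqt /\
        R ⊆ Tqt /\ is_pair r st R /\ direct_ext X U r qt /\ r ∈ D.

End SetTheory.

Definition extensionality (V : set_structure) : Prop :=
  forall a b : V, (forall x, x ∈ a <-> x ∈ b) -> a = b.

Definition foundation (V : set_structure) : Prop :=
  forall a : V, (exists x, x ∈ a) -> exists x, x ∈ a /\ forall y, ~ (y ∈ x /\ y ∈ a).

Definition pairing (V : set_structure) : Prop :=
  forall a b : V, exists c, is_upair c a b.

Definition union (V : set_structure) : Prop :=
  forall a : V, exists b, forall x, x ∈ b <-> exists y, x ∈ y /\ y ∈ a.

Definition power_set (V : set_structure) : Prop :=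
  forall a : V, exists b : V, forall x, x ∈ b <-> x ⊆ a.

Definition infinity (V : set_structure) : Prop :=
  exists w : V, inductive w.

Definition separation (V : set_structure) : Prop :=
  forall (phi : formula) (rho : nat -> V) (a : V),
    exists b, forall x, x ∈ b <-> x ∈ a /\ sat V (x .: rho) phi.

Definition replacement (V : set_structure) : Prop :=
  forall (phi : formula) (rho : nat -> V) (a : V),
    (forall x y y', x ∈ a -> sat V (x .: y .: rho) phi ->
      sat V (x .: y' .: rho) phi -> y = y') ->
    exists b, forall y, y ∈ b <-> exists x, x ∈ a /\ sat V (x .: y .: rho) phi.

Definition ZF (V : set_structure) : Prop :=
  extensionality V /\ foundation V /\ pairing V /\ union V /\ power_set V /\
  infinity V /\ separation V /\ replacement V.

(* Main.v *)
From Stdlib Require Import Classical.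
Require Import Defs.

(** Write p = (s, T).  A node t of T is _decided_ when some condition in D that
    extends p has the form (s⌢t, R) with R ⊆ T_t.  The theorem asks for a large
    subtree of T, and a level n from which on every node of it is decided.

    No choice is needed because the property is preserved under unions.  Let the
    n-th kernel be the union of all sets S ⊆ T such that each node of S has
    U-many successors in S and each node of S of length at least n is decided.
    It is itself such a set, in fact the largest one, and it is defined without
    recursion and without selecting witnesses.  If the empty sequence is in some
    kernel, take the least such n, and let T^q consist of the nodes all of whose
    initial segments are in the n-th kernel ([canonical_choice]).  This T^q is a
    large tree ([hereditary_part_large]).  If t ∈ T^q is decided by (s⌢t, R),
    then (s⌢t, R ∩ T^q_t) is in D because D is open ([decided_shrink]).

    It remains to see that the empty sequence is in some kernel
    ([root_in_kernel]).  The kernels increase with n, and a node t of length less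
    than n with U-many successors in the n-th kernel is in it too
    ([in_kernel_lift]).  By σ-completeness, if U-many successors of t are in
    kernels, then U-many are in one and the same kernel, of arbitrarily large
    index, hence t is in a kernel ([in_kernel_of_successors]).  So a node outside
    all kernels has U-many successors outside all kernels.  If the empty sequence
    were such a node, the nodes all of whose initial segments are outside all
    kernels would form a large tree H ⊆ T.  By density some extension of (s, H)
    is in D; its stem is s⌢t with t ∈ H, and t is decided.  But openness of D
    passes decidedness on to U-many successors ([decided_splits]), so that
    decided nodes are in the kernel with index 0 ([decided_in_kernel]), a
    contradiction.

    All of this takes place inside an arbitrary model of ZF.  Separation is an
    axiom scheme over coded formulas, and it is what induction on the natural
    numbers of the model rests on; so every predicate in use is shown to be the
    meaning of a formula ([definable]), which the tactics [definable] and
    [separable] do by recursion on the shape of the predicate.  The same device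
    produces the formula that the theorem asserts to exist. *)

(** * Definable predicates *)

(** A variable is a lookup in the assignment [rho].  The predicate is given for
    all structures at once, so that one formula serves them all. *)
Definition definable (P : forall V : set_structure, (nat -> V) -> Prop) : Prop :=
  exists phi, forall V rho, sat V rho phi <-> P V rho.

Lemma definable_mem i j : definable (fun V rho => rho i ∈ rho j).
Proof. exists (f_mem i j); reflexivity. Qed.

Lemma definable_eq i j : definable (fun V rho => rho i = rho j).
Proof. exists (f_eq i j); reflexivity. Qed.

Lemma definable_false : definable (fun V rho => False).
Proof. exists f_false; reflexivity. Qed.

Lemma definable_and P Q : definable P -> definable Q ->
  definable (fun V rho => P V rho /\ Q V rho).
Proof.
  intros [f Hf] [g Hg]; exists (f_and f g); intros V rho; simpl.
  now rewrite Hf, Hg.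
Qed.

Lemma definable_or P Q : definable P -> definable Q ->
  definable (fun V rho => P V rho \/ Q V rho).
Proof.
  intros [f Hf] [g Hg]; exists (f_or f g); intros V rho; simpl.
  now rewrite Hf, Hg.
Qed.

Lemma definable_imp P Q : definable P -> definable Q ->
  definable (fun V rho => P V rho -> Q V rho).
Proof.
  intros [f Hf] [g Hg]; exists (f_imp f g); intros V rho; simpl.
  now rewrite Hf, Hg.
Qed.

(** The premise exposes the bound variable as entry 0 of a shifted assignment,
    so that repeated application turns bound variables into lookups. *)
Lemma definable_all (P : forall V : set_structure, (nat -> V) -> V -> Prop) :
  definable (fun V rho => P V (fun i => rho (S i)) (rho 0)) ->
  definable (fun V rho => forall a, P V rho a).
Proof.
  intros [f Hf]; exists (f_all f); intros V rho; simpl; split; intros H a.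
  - exact (proj1 (Hf V (a .: rho)) (H a)).
  - exact (proj2 (Hf V (a .: rho)) (H a)).
Qed.

Lemma definable_ex (P : forall V : set_structure, (nat -> V) -> V -> Prop) :
  definable (fun V rho => P V (fun i => rho (S i)) (rho 0)) ->
  definable (fun V rho => exists a, P V rho a).
Proof.
  intros [f Hf]; exists (f_ex f); intros V rho; simpl; split; intros [a H]; exists a.
  - exact (proj1 (Hf V (a .: rho)) H).
  - exact (proj2 (Hf V (a .: rho)) H).
Qed.

Create HintDb definable.
#[export] Hint Resolve definable_mem definable_eq definable_false : definable.

Ltac definable_step :=
  cbv beta;
  first
  [ solve [auto 1 with definable nocore]
  | simple apply definable_and
  | simple apply definable_or
  | simple apply definable_ex
  | simple apply definable_imp
  | simple apply definable_all
  | lazymatch goal with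
    | |- definable (fun V rho => ~ _) => unfold not
    | |- definable (fun V rho => _ <-> _) => unfold iff
    | |- definable (fun V rho => @unique _ _ _) => unfold unique
    | |- definable (fun V rho => @subset _ _ _) => unfold subset
    end ].
Ltac definable := intros; repeat definable_step.

Lemma definable_is_empty i : definable (fun V rho => is_empty (rho i)).
Proof. unfold is_empty; definable. Qed.
#[export] Hint Resolve definable_is_empty : definable.

Lemma definable_is_pair i j k :
  definable (fun V rho => is_pair (rho i) (rho j) (rho k)).
Proof. unfold is_pair, is_upair; definable. Qed.
#[export] Hint Resolve definable_is_pair : definable.

Lemma definable_is_succ i j : definable (fun V rho => is_succ (rho i) (rho j)).
Proof. unfold is_succ; definable. Qed.
#[export] Hint Resolve definable_is_succ : definable.

Lemma definable_natural i : definable (fun V rho => natural (rho i)).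
Proof. unfold natural, inductive; definable. Qed.
#[export] Hint Resolve definable_natural : definable.

Lemma definable_app i j k : definable (fun V rho => app (rho i) (rho j) (rho k)).
Proof. unfold app; definable. Qed.
#[export] Hint Resolve definable_app : definable.

Lemma definable_function_on i j :
  definable (fun V rho => function_on (rho i) (rho j)).
Proof. unfold function_on; definable. Qed.
#[export] Hint Resolve definable_function_on : definable.

Lemma definable_seq i j k : definable (fun V rho => seq (rho i) (rho j) (rho k)).
Proof. unfold seq, maps; definable. Qed.
#[export] Hint Resolve definable_seq : definable.

Lemma definable_finseq i j : definable (fun V rho => finseq (rho i) (rho j)).
Proof. unfold finseq; definable. Qed.
#[export] Hint Resolve definable_finseq : definable.

Lemma definable_is_shift i j k :
  definable (fun V rho => is_shift (rho i) (rho j) (rho k)).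
Proof. unfold is_shift; definable. Qed.
#[export] Hint Resolve definable_is_shift : definable.

Lemma definable_is_cat i j k l :
  definable (fun V rho => is_cat (rho i) (rho j) (rho k) (rho l)).
Proof. unfold is_cat; definable. Qed.
#[export] Hint Resolve definable_is_cat : definable.

Lemma definable_is_snoc i j k l :
  definable (fun V rho => is_snoc (rho i) (rho j) (rho k) (rho l)).
Proof. unfold is_snoc, is_single; definable. Qed.
#[export] Hint Resolve definable_is_snoc : definable.

(** Separation for [P], where [P] may mention elements of the model. *)
Definition separable {V : set_structure} (P : V -> Prop) : Prop :=
  forall a, exists b, forall x, x ∈ b <-> x ∈ a /\ P x.

Lemma definable_separable (Q : forall V : set_structure, (nat -> V) -> Prop) :
  definable Q -> forall V, ZF V -> forall rho, separable (fun x => Q V (x .: rho)).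
Proof.
  intros [phi H] V (_ & _ & _ & _ & _ & _ & sep & _) rho a.
  destruct (sep phi rho a) as [b Hb]; exists b; intros x.
  rewrite Hb, H; reflexivity.
Qed.

(** Elements of the model mentioned in the predicate become entries of the
    assignment: [F r x] is the predicate of [x] in which those treated so far
    have been replaced by lookups in [r], and [e] is the assignment that gives
    their values. *)
Ltac separable_loop zf V F e :=
  match F with
  | context [?v] =>
      is_var v;
      let t := type of v in
      let u := eval cbn in t in
      constr_eq u (dom V);
      let G := eval pattern v in F in
      lazymatch G with
      | ?G' v =>
        let F' := eval cbv beta in
          (fun (r : nat -> V) (x : V) => G' (r 0) (fun i => r (S i)) x) in
        separable_loop zf V F' (v .: e)
      end
  | _ =>
      let Q := eval cbv beta in (fun r : nat -> V => F (fun i => r (S i)) (r 0)) in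
      let Q' := eval pattern V in Q in
      lazymatch Q' with
      | ?R V => 
        let R' := eval cbv beta in (fun W : set_structure => R W) in
        refine (definable_separable R' _ V zf e)
      end
  end.
(** An assignment needs a value at every index; the set to be separated from
    provides one. *)
Lemma separable_inhabited {V : set_structure} (P : V -> Prop) :
  (V -> separable P) -> separable P.
Proof. intros H a; exact (H a a). Qed.

Ltac separable :=
  intros;
  lazymatch goal with
  | zf : ZF ?V |- separable ?P =>
      let d := fresh in
      apply separable_inhabited; intros d;
      let F := eval cbv beta in (fun (r : nat -> V) (x : V) => P x) in
      separable_loop zf V F (fun _ : nat => d)
  end;
  definable.


(** * The predicates of the proof *)

Section Predicates.
Context {V : set_structure}.
Implicit Types i j k m g : V.

(** k + i = j, read off from a shift that may be longer than i, so that every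
    value of the shift occurring in a concatenation is an instance. *)
Definition plus k i j : Prop :=
  exists m g, natural m /\ is_shift g k m /\ (i ∈ m \/ i = m) /\ app g i j.

End Predicates.

Lemma definable_plus i j k : definable (fun V rho => plus (rho i) (rho j) (rho k)).
Proof. unfold plus; definable. Qed.
#[export] Hint Resolve definable_plus : definable.


Section TreePredicates.
Context {V : set_structure}.
Implicit Types X U p q D s t u v w x A R S T r n e : V.

(** For an ultrafilter this is succ_S(t) ∈ U.  Asking only for a subset of
    succ_S(t) that is in U makes it monotone in S at sight. *)
Definition splits X U S t : Prop :=
  exists A, A ∈ U /\ forall x, x ∈ A -> exists u, is_snoc X t x u /\ u ∈ S.

(** [r] is of the form (s⌢t, R) with t ∈ T and R ⊆ T_t; so conditions [r] of this
    form are the direct extensions of (s⌢t, T_t). *)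
Definition at_node X s T t r : Prop :=
  exists st R, is_pair r st R /\ is_cat X s t st /\ t ∈ T /\
    forall v, v ∈ R -> exists w, is_cat X t v w /\ w ∈ T.

(** That [r] extends [p] is part of the definition because openness of [D] is
    only available there. *)
Definition decided X U p D s T t : Prop :=
  exists r, r ∈ D /\ extends X U r p /\ at_node X s T t r.

(** The n-th kernel as a greatest fixed point: the union of all sets of nodes
    that split within themselves and are decided from length n on.  Lengths are
    measured from the root of T, not from t. *)
Definition in_kernel X U p D s T n t : Prop :=
  exists S, t ∈ S /\ S ⊆ T /\ (forall u, u ∈ S -> splits X U S u) /\
    (forall u, u ∈ S -> length_ge X u n -> decided X U p D s T u).

Definition canonical_choice X U p D q n : Prop :=
  exists s T e Tq, is_pair p s T /\ is_empty e /\
    natural n /\ in_kernel X U p D s T n e /\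
    (forall m, m ∈ n -> ~ in_kernel X U p D s T m e) /\
    is_pair q s Tq /\
    forall t, t ∈ Tq <-> t ∈ T /\ forall u, finseq X u -> u ⊆ t -> in_kernel X U p D s T n u.

End TreePredicates.

Lemma definable_is_cond i j k l m :
  definable (fun V rho => is_cond (rho i) (rho j) (rho k) (rho l) (rho m)).
Proof. unfold is_cond, large_tree, tree, is_tree_succ; definable. Qed.
#[export] Hint Resolve definable_is_cond : definable.

Lemma definable_direct_ext i j k l :
  definable (fun V rho => direct_ext (rho i) (rho j) (rho k) (rho l)).
Proof. unfold direct_ext; definable. Qed.
#[export] Hint Resolve definable_direct_ext : definable.

Lemma definable_one_point_ext i j k l :
  definable (fun V rho => one_point_ext (rho i) (rho j) (rho k) (rho l)).
Proof. unfold one_point_ext, is_tree_succ, is_single, is_subtree_at; definable. Qed.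
#[export] Hint Resolve definable_one_point_ext : definable.

Lemma definable_extends i j k l :
  definable (fun V rho => extends (rho i) (rho j) (rho k) (rho l)).
Proof. unfold extends, condition; definable. Qed.
#[export] Hint Resolve definable_extends : definable.

Lemma definable_at_node i j k l m :
  definable (fun V rho => at_node (rho i) (rho j) (rho k) (rho l) (rho m)).
Proof. unfold at_node; definable. Qed.
#[export] Hint Resolve definable_at_node : definable.

Lemma definable_decided i j k l m a b :
  definable (fun V rho =>
    decided (rho i) (rho j) (rho k) (rho l) (rho m) (rho a) (rho b)).
Proof. unfold decided; definable. Qed.
#[export] Hint Resolve definable_decided : definable.

Lemma definable_in_kernel i j k l m a b c :
  definable (fun V rho =>
    in_kernel (rho i) (rho j) (rho k) (rho l) (rho m) (rho a) (rho b) (rho c)).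
Proof. unfold in_kernel, splits, length_ge; definable. Qed.
#[export] Hint Resolve definable_in_kernel : definable.

Lemma definable_canonical_choice i j k l m a :
  definable (fun V rho =>
    canonical_choice (rho i) (rho j) (rho k) (rho l) (rho m) (rho a)).
Proof. unfold canonical_choice; definable. Qed.
#[export] Hint Resolve definable_canonical_choice : definable.

(** * Pairs and functions *)

Section Model.
Context {V : set_structure} (zf : ZF V).

Lemma ext (a b : V) : (forall x, x ∈ a <-> x ∈ b) -> a = b.
Proof. destruct zf as [H _]; exact (H a b). Qed.

Lemma upair_exists (a b : V) : exists c, is_upair c a b.
Proof. destruct zf as (_ & _ & H & _); exact (H a b). Qed.

Lemma union2_exists (a b : V) : exists c, forall x, x ∈ c <-> x ∈ a \/ x ∈ b.
Proof.
  destruct (upair_exists a b) as [d Hd].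
  destruct zf as (_ & _ & _ & H & _); destruct (H d) as [c Hc]; exists c; intros x.
  rewrite Hc; split.
  - intros (y & Hx & Hy); apply Hd in Hy as [-> | ->]; auto.
  - intros [Hx | Hx]; [exists a | exists b]; split; auto; apply Hd; auto.
Qed.

Lemma adjoin_exists (a b : V) : exists c, forall x, x ∈ c <-> x ∈ a \/ x = b.
Proof.
  destruct (upair_exists b b) as [d Hd], (union2_exists a d) as [c Hc].
  exists c; intros x; rewrite Hc, (Hd x); tauto.
Qed.

Lemma empty_exists : exists e : V, is_empty e.
Proof.
  destruct zf as (_ & _ & _ & _ & _ & [w [[e [H _]] _]] & _); now exists e.
Qed.

Lemma empty_unique (a b : V) : is_empty a -> is_empty b -> a = b.
Proof. intros Ha Hb; apply ext; intros x; split; intros H;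
  [now apply Ha in H | now apply Hb in H]. Qed.

Lemma pair_exists (a b : V) : exists p, is_pair p a b.
Proof.
  destruct (upair_exists a a) as [c Hc], (upair_exists a b) as [d Hd],
    (upair_exists c d) as [p Hp].
  exists p, c, d; auto.
Qed.

Lemma upair_unique (c d a b : V) : is_upair c a b -> is_upair d a b -> c = d.
Proof. intros Hc Hd; apply ext; intros x; rewrite (Hc x), (Hd x); reflexivity. Qed.

Lemma pair_unique (p q a b : V) : is_pair p a b -> is_pair q a b -> p = q.
Proof.
  intros (c & d & Hc & Hd & Hp) (c' & d' & Hc' & Hd' & Hq).
  rewrite (upair_unique c' c a a) in Hq by auto.
  rewrite (upair_unique d' d a b) in Hq by auto.
  now apply upair_unique with c d.
Qed.

Lemma pair_inj (p a b a' b' : V) : is_pair p a b -> is_pair p a' b' -> a = a' /\ b = b'.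
Proof.
  intros (c & d & Hc & Hd & Hp) (c' & d' & Hc' & Hd' & Hp').
  assert (Ha : a = a').
  { assert (H : c' ∈ p) by (apply Hp'; auto).
    assert (Ha' : a' ∈ c') by (apply Hc'; auto).
    apply Hp in H as [-> | ->].
    - apply Hc in Ha'; destruct Ha'; auto.
    - assert (H : a ∈ d) by (apply Hd; auto).
      apply Hc' in H; destruct H; auto. }
  subst a'; split; auto.
  assert (c' = c) by (now apply upair_unique with a a); subst c'.
  assert (Hdd : d = d').
  { assert (H : d ∈ p) by (apply Hp; auto).
    assert (H' : d' ∈ p) by (apply Hp'; auto).
    apply Hp' in H as [H | H]; auto.
    apply Hp in H' as [H' | H']; congruence. }
  subst d'.
  assert (Hb : b ∈ d) by (apply Hd; auto).
  assert (Hb' : b' ∈ d) by (apply Hd'; auto).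
  apply Hd in Hb'; apply Hd' in Hb.
  destruct Hb, Hb'; congruence.
Qed.

Lemma product_exists (a b : V) :
  exists c, forall p, p ∈ c <-> exists x y, x ∈ a /\ y ∈ b /\ is_pair p x y.
Proof.
  destruct (union2_exists a b) as [u Hu].
  pose proof zf as (_ & _ & _ & _ & pow & _).
  destruct (pow u) as [u1 H1], (pow u1) as [u2 H2].
  assert (sep : separable (fun p => exists x y, x ∈ a /\ y ∈ b /\ is_pair p x y))
    by separable.
  destruct (sep u2) as [c Hc]; exists c; intros p; rewrite Hc; split; [tauto|].
  intros (x & y & Hx & Hy & Hp); split; [|now exists x, y].
  apply H2; intros z Hz; apply H1; intros v Hv; apply Hu.
  destruct Hp as (d & e & Hd & He & Hp).
  apply Hp in Hz as [-> | ->]; [apply Hd in Hv | apply He in Hv];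
    destruct Hv as [-> | ->]; auto.
Qed.

Lemma app_dom (f a x y : V) : function_on f a -> app f x y -> x ∈ a.
Proof.
  intros [H _] (p & Hp & Hf); destruct (H p Hf) as (x' & y' & Hx & Hp').
  now destruct (pair_inj p x y x' y') as [-> _].
Qed.

Lemma app_fun (f a x y y' : V) : function_on f a -> app f x y -> app f x y' -> y = y'.
Proof.
  intros Hf H H'; destruct Hf as [Hf1 Hf2] eqn:E.
  destruct (Hf2 x (app_dom f a x y Hf H)) as (z & _ & Hz).
  rewrite <- (Hz y H); auto.
Qed.

Lemma app_total (f a x : V) : function_on f a -> x ∈ a -> exists y, app f x y.
Proof. intros [_ H] Hx; destruct (H x Hx) as (y & Hy & _); now exists y. Qed.

Lemma function_subset (f g a b : V) : function_on f a -> function_on g b ->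
  (f ⊆ g <-> forall x y, app f x y -> app g x y).
Proof.
  intros [Hf _] Hg; split.
  - intros H x y (p & Hp & Hpf); exists p; auto.
  - intros H p Hp; destruct (Hf p Hp) as (x & y & _ & Hxy).
    destruct (H x y) as (q & Hq & Hqg); [now exists p|].
    now rewrite (pair_unique p q x y).
Qed.

Lemma function_ext (f g a b : V) : function_on f a -> function_on g b ->
  (forall x y, app f x y <-> app g x y) -> f = g.
Proof.
  intros Hf Hg H; apply ext; intros p; split.
  - apply (proj2 (function_subset f g a b Hf Hg)); intros; now apply H.
  - apply (proj2 (function_subset g f b a Hg Hf)); intros; now apply H.
Qed.

Lemma dom_unique (f a b : V) : function_on f a -> function_on f b -> a = b.
Proof.
  intros Ha Hb; apply ext; intros x; split; intros H.
  - destruct (app_total f a x Ha H) as [y Hy]; now apply app_dom with f y.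
  - destruct (app_total f b x Hb H) as [y Hy]; now apply app_dom with f y.
Qed.

(** Replacement is avoided by giving a codomain in advance. *)
Lemma function_by_graph (a b : V) (R : V -> V -> Prop) :
  separable (fun p => exists x y, is_pair p x y /\ R x y) ->
  (forall x, x ∈ a -> exists! y, R x y) ->
  (forall x y, x ∈ a -> R x y -> y ∈ b) ->
  exists f, maps f a b /\ forall x y, app f x y <-> x ∈ a /\ R x y.
Proof.
  intros sep HR Hb; destruct (product_exists a b) as [c Hc].
  destruct (sep c) as [f Hf]; exists f.
  assert (Happ : forall x y, app f x y <-> x ∈ a /\ R x y).
  { intros x y; split.
    - intros (p & Hp & H); apply Hf in H as (H & x1 & y1 & Hp1 & H1).
      apply Hc in H as (x2 & y2 & Hx & _ & Hp2).
      destruct (pair_inj p x y x1 y1), (pair_inj p x y x2 y2); auto; subst; auto.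
    - intros [Hx H]; destruct (pair_exists x y) as [p Hp]; exists p; split; auto.
      apply Hf; split; [apply Hc|]; exists x, y; eauto. }
  split; auto; split; [split|].
  - intros p Hp; apply Hf in Hp as [Hp _].
    apply Hc in Hp as (x & y & Hx & _ & Hp); eauto.
  - intros x Hx; destruct (HR x Hx) as (y & Hy & Hu); exists y; split.
    + now apply Happ.
    + intros y' Hy'; apply Happ in Hy' as [_ Hy']; auto.
  - intros x y H; apply Happ in H as [Hx H]; eauto.
Qed.

Lemma function_extend (f a a' x y : V) :
  function_on f a -> ~ x ∈ a -> (forall z, z ∈ a' <-> z ∈ a \/ z = x) ->
  exists f', function_on f' a' /\
    forall u v, app f' u v <-> app f u v \/ u = x /\ v = y.
Proof.
  intros Hf Hx Ha'; destruct (pair_exists x y) as [p Hp].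
  destruct (adjoin_exists f p) as [f' Hf']; exists f'.
  assert (Happ : forall u v, app f' u v <-> app f u v \/ u = x /\ v = y).
  { intros u v; split.
    - intros (q & Hq & H); apply Hf' in H as [H | ->]; [left; now exists q|].
      right; now apply pair_inj with p.
    - intros [(q & Hq & H) | [-> ->]].
      + exists q; rewrite Hf'; auto.
      + exists p; rewrite Hf'; auto. }
  split; auto; split.
  - intros q Hq; apply Hf' in Hq as [Hq | ->].
    + destruct Hf as [Hf _]; destruct (Hf q Hq) as (u & v & Hu & Hv).
      exists u, v; rewrite Ha'; auto.
    + exists x, y; rewrite Ha'; auto.
  - intros u Hu; apply Ha' in Hu as [Hu | ->].
    + destruct (app_total f a u Hf Hu) as [v Hv]; exists v; split.
      * apply Happ; auto.
      * intros v' H; apply Happ in H as [H | [-> _]]; [|contradiction].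
        now apply app_fun with f a u.
    + exists y; split; [apply Happ; auto|].
      intros v' H; apply Happ in H as [H | [_ H]]; auto.
      now apply app_dom with (a := a) in H.
Qed.

(** * Natural numbers *)

Lemma succ_exists (a : V) : exists b, is_succ b a.
Proof. exact (adjoin_exists a a). Qed.

Lemma succ_unique (a b b' : V) : is_succ b a -> is_succ b' a -> b = b'.
Proof. intros H H'; apply ext; intros x; rewrite (H x), (H' x); reflexivity. Qed.

Lemma succ_self (a b : V) : is_succ b a -> a ∈ b.
Proof. intros H; apply H; auto. Qed.

Lemma natural_induction (P : V -> Prop) : separable P ->
  (forall z, is_empty z -> P z) ->
  (forall n n', natural n -> P n -> is_succ n' n -> P n') ->
  forall n, natural n -> P n.
Proof.
  intros sep H0 HS.
  destruct zf as (_ & _ & _ & _ & _ & [w Hw] & _).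
  assert (sepN : separable (fun n => natural n)) by separable.
  destruct (sepN w) as [v Hv], (sep v) as [b Hb].
  assert (Hi : inductive b).
  { split.
    - destruct empty_exists as [e He]; exists e; split; auto.
      apply Hb; split; auto; apply Hv.
      assert (natural e).
      { intros w' [(e' & He' & H) _]; now rewrite (empty_unique e e'). }
      auto.
    - intros n Hn; apply Hb in Hn as [Hn Pn]; apply Hv in Hn as [Hn Nn].
      destruct (succ_exists n) as [n' Hn']; exists n'; split; auto.
      assert (natural n').
      { intros w' Hw'; destruct Hw' as [Hw1 Hw2] eqn:E.
        destruct (Hw2 n (Nn w' Hw')) as (b' & Hb' & Hin).
        now rewrite (succ_unique n n' b'). }
      apply Hb; split; [apply Hv; auto|]; eauto. }
  intros n Hn; now apply Hn, Hb in Hi.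
Qed.

Ltac induct_natural :=
  lazymatch goal with
  | |- forall n, natural n -> @?P n =>
      refine (natural_induction P _ _ _); cbv beta
  end.

Lemma natural_zero (z : V) : is_empty z -> natural z.
Proof. intros Hz w [(e & He & H) _]; now rewrite (empty_unique z e). Qed.

Lemma natural_succ (n n' : V) : natural n -> is_succ n' n -> natural n'.
Proof.
  intros Hn Hn' w Hw; destruct Hw as [H1 H2] eqn:E.
  destruct (H2 n (Hn w Hw)) as (b & Hb & H).
  now rewrite (succ_unique n n' b).
Qed.

Lemma omega_exists : exists w : V, is_omega w.
Proof.
  pose proof zf as (_ & _ & _ & _ & _ & [w Hw] & _).
  assert (sep : separable (fun n => natural n)) by separable.
  destruct (sep w) as [v Hv]; exists v; intros n; rewrite Hv; split; [tauto|].
  intros H; split; auto.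
Qed.

Lemma natural_elem (n : V) : natural n -> forall m, m ∈ n -> natural m.
Proof.
  revert n; induct_natural; [separable| |].
  - intros z Hz m Hm; now apply Hz in Hm.
  - intros n n' Hn IH Hn' m Hm; apply Hn' in Hm as [Hm | ->]; auto.
Qed.

Lemma natural_trans (n : V) : natural n -> forall m k, k ∈ m -> m ∈ n -> k ∈ n.
Proof.
  revert n; induct_natural; [separable| |].
  - intros z Hz m k _ Hm; now apply Hz in Hm.
  - intros n n' Hn IH Hn' m k Hk Hm; apply Hn'; left.
    apply Hn' in Hm as [Hm | ->]; eauto.
Qed.

Lemma mem_irrefl (a : V) : ~ a ∈ a.
Proof.
  intros H; pose proof zf as (_ & found & _).
  destruct (upair_exists a a) as [c Hc].
  destruct (found c) as (x & Hx & Hd); [exists a; apply Hc; auto|].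
  assert (x = a) by (apply Hc in Hx; tauto); subst x.
  exact (Hd a (conj H Hx)).
Qed.

Lemma natural_zero_or_succ (n : V) : natural n ->
  is_empty n \/ exists m, natural m /\ is_succ n m.
Proof.
  revert n; induct_natural; [separable|auto|].
  intros n n' Hn _ Hn'; right; now exists n.
Qed.

Lemma zero_le (z n : V) : is_empty z -> natural n -> z ∈ n \/ z = n.
Proof.
  intros Hz; revert n; induct_natural; [separable| |].
  - intros z' Hz'; right; now apply empty_unique.
  - intros n n' _ IH Hn'; left; apply Hn'; tauto.
Qed.

Lemma succ_lt (n : V) : natural n ->
  forall n' m m', m ∈ n -> is_succ n' n -> is_succ m' m -> m' ∈ n'.
Proof.
  revert n; induct_natural; [separable| |].
  - intros z Hz n' m m' Hm; now apply Hz in Hm.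
  - intros n n1 Hn IH Hn1 n2 m m' Hm Hn2 Hm'.
    apply Hn2; apply Hn1 in Hm as [Hm | ->].
    + left; eauto.
    + right; now apply succ_unique with n.
Qed.

Lemma natural_total (n : V) : natural n ->
  forall m, natural m -> n ∈ m \/ n = m \/ m ∈ n.
Proof.
  revert n; induct_natural; [separable| |].
  - intros z Hz m Hm; destruct (zero_le z m Hz Hm); auto.
  - intros n n' Hn IH Hn' m Hm.
    destruct (IH m Hm) as [H | [E | H]].
    + destruct (natural_zero_or_succ m Hm) as [Hz | (k & Hk & Hmk)]; [now apply Hz in H|].
      destruct (proj1 (Hmk n) H) as [H' | E].
      * left; eapply succ_lt; eauto.
      * right; left; subst k; now apply succ_unique with n.
    + right; right; apply Hn'; auto.
    + right; right; apply Hn'; auto.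
Qed.

(** * Addition *)

Lemma shift_exists (k m : V) : natural m -> exists g, is_shift g k m.
Proof.
  revert m; induct_natural; [separable| |].
  - intros z Hz; destruct (succ_exists z) as [o Ho].
    assert (Hf : function_on z z).
    { split; intros x Hx; now apply Hz in Hx. }
    destruct (function_extend z z o z k Hf (Hz z) Ho) as (g & Hg & Happ).
    exists g; split; [|split].
    + now exists o.
    + exists z; split; auto; apply Happ; auto.
    + intros i i' j j' Hi; now apply Hz in Hi.
  - intros m m' Hm (g & (m1 & Hm1 & Hg) & (z & Hz & Hgz) & Hs) Hm'.
    rewrite (succ_unique m m1 m') in * by auto; clear m1 Hm1.
    destruct (app_total g m' m Hg (succ_self m m' Hm')) as [j Hj].
    destruct (succ_exists j) as [j' Hj'], (succ_exists m') as [m'' Hm''].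
    destruct (function_extend g m' m'' m' j' Hg (mem_irrefl m') Hm'') as (g' & Hg' & Happ).
    exists g'; split; [|split].
    + now exists m''.
    + exists z; split; auto; apply Happ; auto.
    + intros i i' a a' Hi Hi' Ha Ha'; apply Happ.
      apply Happ in Ha as [Ha | [-> _]]; [|now apply mem_irrefl in Hi].
      destruct (proj1 (Hm' i) Hi) as [H | ->].
      * left; exact (Hs i i' a a' H Hi' Ha Ha').
      * right; split; [now apply succ_unique with m|].
        rewrite (app_fun g m' m a j Hg Ha Hj) in Ha'.
        now apply succ_unique with j.
Qed.

(** Shifts of different lengths agree where both are defined, so sums do not
    depend on the shift used to compute them. *)
Lemma shift_agree (g g' k m m' : V) :
  natural m -> natural m' -> is_shift g k m -> is_shift g' k m' ->
  forall i, natural i -> i ∈ m \/ i = m -> i ∈ m' \/ i = m' ->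
  forall j j', app g i j -> app g' i j' -> j = j'.
Proof.
  intros Hm Hm' ((n & Hn & Hg) & (z & Hz & Hgz) & Hs)
    ((n' & Hn' & Hg') & (z' & Hz' & Hgz') & Hs').
  induct_natural; [separable| |].
  - intros i Hi _ _ j j' Hj Hj'.
    rewrite (empty_unique i z) in Hj by auto.
    rewrite (empty_unique i z') in Hj' by auto.
    rewrite (app_fun g n z j k Hg Hj Hgz).
    now rewrite (app_fun g' n' z' j' k Hg' Hj' Hgz').
  - intros i i' Hi IH Hi' Hlt Hlt' j j' Hj Hj'.
    assert (Him : i ∈ m).
    { assert (H : i ∈ i') by now apply succ_self.
      destruct Hlt as [Hlt | <-]; auto; now apply natural_trans with i'. }
    assert (Him' : i ∈ m').
    { assert (H : i ∈ i') by now apply succ_self.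
      destruct Hlt' as [Hlt' | <-]; auto; now apply natural_trans with i'. }
    destruct (app_total g n i Hg) as [a Ha]; [apply Hn; auto|].
    destruct (app_total g' n' i Hg') as [a' Ha']; [apply Hn'; auto|].
    assert (E : a = a') by (apply IH; auto); subst a'.
    destruct (succ_exists a) as [b Hb].
    rewrite (app_fun g n i' j b Hg Hj (Hs i i' a b Him Hi' Ha Hb)).
    now rewrite (app_fun g' n' i' j' b Hg' Hj' (Hs' i i' a b Him' Hi' Ha' Hb)).
Qed.

Lemma plus_fun (k i j j' : V) : natural i -> plus k i j -> plus k i j' -> j = j'.
Proof.
  intros Hi (m & g & Hm & Hg & Him & Hj) (m' & g' & Hm' & Hg' & Him' & Hj').
  exact (shift_agree g g' k m m' Hm Hm' Hg Hg' i Hi Him Him' j j' Hj Hj').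
Qed.

Lemma shift_total (g k m i : V) : is_shift g k m -> i ∈ m \/ i = m -> exists j, app g i j.
Proof.
  intros ((n & Hn & Hg) & _) Hi; apply app_total with n; auto; now apply Hn.
Qed.

Lemma shift_plus (g k m i j : V) : natural m -> is_shift g k m -> i ∈ m \/ i = m ->
  (app g i j <-> plus k i j).
Proof.
  intros Hm Hg Hi.
  assert (H : forall a, app g i a -> plus k i a) by (intros a Ha; now exists m, g).
  split; auto; intros Hj.
  destruct (shift_total g k m i Hg Hi) as [a Ha].
  assert (Ni : natural i) by (destruct Hi as [Hi | ->]; auto; now apply natural_elem with m).
  now rewrite (plus_fun k i j a) by auto.
Qed.

Lemma plus_total (k i : V) : natural i -> exists j, plus k i j.
Proof.
  intros Hi; destruct (shift_exists k i Hi) as [g Hg].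
  destruct (shift_total g k i i Hg) as [j Hj]; auto.
  exists j; apply (shift_plus g k i i j); auto.
Qed.

Lemma plus_zero (k z : V) : is_empty z -> plus k z k.
Proof.
  intros Hz; pose proof (natural_zero z Hz) as Nz.
  destruct (shift_exists k z Nz) as [g Hg].
  apply (shift_plus g k z z k); auto.
  destruct Hg as (_ & (z' & Hz' & H) & _); now rewrite (empty_unique z z').
Qed.

Lemma plus_succ (k i i' j j' : V) : natural i ->
  plus k i j -> is_succ i' i -> is_succ j' j -> plus k i' j'.
Proof.
  intros Hi Hp Hi' Hj'; assert (Ni' := natural_succ i i' Hi Hi').
  (* one shift long enough for both arguments, so that its recursion clause relates them *)
  destruct (shift_exists k i' Ni') as [g Hg].
  assert (Hlt : i ∈ i') by now apply succ_self.
  apply (shift_plus g k i' i' j'); auto.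
  apply (shift_plus g k i' i j) in Hp; auto.
  destruct Hg as (_ & _ & Hs).
  exact (Hs i i' j j' Hlt Hi' Hp Hj').
Qed.

Lemma plus_succ_inv (k i i' j' : V) : natural i -> is_succ i' i ->
  plus k i' j' -> exists j, plus k i j /\ is_succ j' j.
Proof.
  intros Hi Hi' Hp; destruct (plus_total k i Hi) as [j Hj]; exists j; split; auto.
  destruct (succ_exists j) as [a Ha].
  rewrite (plus_fun k i' j' a); auto; [now apply natural_succ with i|].
  now apply plus_succ with i j.
Qed.

Lemma plus_zero_inv (k z j : V) : is_empty z -> plus k z j -> j = k.
Proof.
  intros Hz Hj; apply plus_fun with k z; auto using natural_zero, plus_zero.
Qed.

Lemma plus_natural (k i : V) : natural k -> natural i ->
  forall j, plus k i j -> natural j.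
Proof.
  intros Hk; revert i; induct_natural; [separable| |].
  - intros z Hz j Hj; now rewrite (plus_zero_inv k z j).
  - intros i i' Hi IH Hi' j' Hj'.
    destruct (plus_succ_inv k i i' j') as (j & Hj & HS); auto.
    apply natural_succ with j; auto.
Qed.

Lemma plus_lt (k m : V) : natural k -> natural m ->
  forall i j l, i ∈ m -> plus k i j -> plus k m l -> j ∈ l.
Proof.
  intros Hk; revert m; induct_natural; [separable| |].
  - intros z Hz i j l Hi; now apply Hz in Hi.
  - intros m m' Hm IH Hm' i j l' Hi Hj Hl'.
    destruct (plus_succ_inv k m m' l') as (l & Hl & HS); auto.
    apply HS; apply Hm' in Hi as [Hi | ->]; [left; eauto|].
    right; now apply plus_fun with k m.
Qed.

(** Together with [plus_not_lt] and [plus_inj], this says that the indices of a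
    concatenation split uniquely into those of the two parts. *)
Lemma plus_split (k m : V) : natural m ->
  forall j l, plus k m l -> j ∈ l -> j ∈ k \/ exists i, i ∈ m /\ plus k i j.
Proof.
  revert m; induct_natural; [separable| |].
  - intros z Hz j l Hl Hj; left; now rewrite <- (plus_zero_inv k z l).
  - intros m m' Hm IH Hm' j l' Hl' Hj.
    destruct (plus_succ_inv k m m' l') as (l & Hl & HS); auto.
    destruct (proj1 (HS j) Hj) as [Hjl | E].
    + destruct (IH j l Hl Hjl) as [H | (i & Hi & H)]; auto.
      right; exists i; split; auto; apply Hm'; auto.
    + right; exists m; rewrite E; split; auto; now apply succ_self.
Qed.

Lemma plus_ge (k i : V) : natural i -> forall j, plus k i j -> k ∈ j \/ k = j.
Proof.
  revert i; induct_natural; [separable| |].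
  - intros z Hz j Hj; right; now rewrite (plus_zero_inv k z j).
  - intros i i' Hi IH Hi' j' Hj'.
    destruct (plus_succ_inv k i i' j') as (j & Hj & HS); auto.
    left; apply HS; auto.
Qed.

Lemma plus_not_lt (k i j : V) : natural k -> natural i -> plus k i j -> ~ j ∈ k.
Proof.
  intros Hk Hi Hj H; destruct (plus_ge k i Hi j Hj) as [Hkj | ->].
  - exact (mem_irrefl k (natural_trans k Hk j k Hkj H)).
  - now apply mem_irrefl in H.
Qed.

Lemma plus_inj (k i i' j : V) : natural k -> natural i -> natural i' ->
  plus k i j -> plus k i' j -> i = i'.
Proof.
  intros Hk Hi Hi' Hj Hj'.
  destruct (natural_total i Hi i' Hi') as [H | [H | H]]; auto; exfalso;
    apply (mem_irrefl j).
  - exact (plus_lt k i' Hk Hi' i j j H Hj Hj').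
  - exact (plus_lt k i Hk Hi i' j j H Hj' Hj).
Qed.

Lemma plus_assoc (a b c : V) : natural b -> natural c ->
  forall ab bc d, plus a b ab -> plus b c bc -> plus ab c d -> plus a bc d.
Proof.
  intros Hb; revert c; induct_natural; [separable| |].
  - intros z Hz ab bc d Hab Hbc Hd.
    now rewrite (plus_zero_inv b z bc), (plus_zero_inv ab z d) by auto.
  - intros c c' Hc IH Hc' ab bc' d' Hab Hbc' Hd'.
    destruct (plus_succ_inv b c c' bc') as (bc & Hbc & HS); auto.
    destruct (plus_succ_inv ab c c' d') as (d & Hd & HS'); auto.
    apply plus_succ with bc d; eauto.
    now apply plus_natural with b c.
Qed.

Lemma plus_zero_l (z i : V) : is_empty z -> natural i -> plus z i i.
Proof.
  intros Hz; revert i; induct_natural; [separable| |].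
  - intros z' Hz'; rewrite (empty_unique z' z) by auto; now apply plus_zero.
  - intros i i' Hi IH Hi'; now apply plus_succ with i i.
Qed.

(** * Finite sequences *)

Lemma seq_dom (X s n i x : V) : seq X s n -> app s i x -> i ∈ n.
Proof. intros (_ & Hs & _) H; now apply app_dom with s x. Qed.

Lemma seq_fun (X s n i x y : V) : seq X s n -> app s i x -> app s i y -> x = y.
Proof. intros (_ & Hs & _); now apply app_fun with n. Qed.

Lemma seq_total (X s n i : V) : seq X s n -> i ∈ n -> exists x, app s i x.
Proof. intros (_ & Hs & _); now apply app_total. Qed.

Lemma seq_val (X s n i x : V) : seq X s n -> app s i x -> x ∈ X.
Proof. intros (_ & _ & H); apply H. Qed.

Lemma seq_index_natural (X s n i : V) : seq X s n -> i ∈ n -> natural i.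
Proof. intros (Hn & _) Hi; now apply natural_elem with n. Qed.

Lemma seq_length (X s n n' : V) : seq X s n -> seq X s n' -> n = n'.
Proof. intros (_ & H & _) (_ & H' & _); now apply dom_unique with s. Qed.

Lemma seq_subset (X s t n m : V) : seq X s n -> seq X t m ->
  (s ⊆ t <-> forall i x, app s i x -> app t i x).
Proof. intros (_ & Hs & _) (_ & Ht & _); now apply function_subset with n m. Qed.

Lemma seq_eq_of_subset (X s t n : V) : seq X s n -> seq X t n -> s ⊆ t -> s = t.
Proof.
  intros Hs Ht H; pose proof (proj1 (seq_subset X s t n n Hs Ht) H) as H'.
  apply function_ext with n n; [apply Hs | apply Ht |].
  intros i x; split; auto; intros Hi.
  destruct (seq_total X s n i Hs) as [y Hy]; [now apply (seq_dom X t n i x)|].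
  now rewrite (seq_fun X t n i x y) by auto.
Qed.

(** Replaces the particular shift in the definition of concatenation by
    addition, which no longer depends on the sequences. *)
Lemma cat_iff (X s t u : V) : is_cat X s t u <->
  exists k m l, seq X s k /\ seq X t m /\ seq X u l /\ plus k m l /\
    (forall i x, app s i x -> app u i x) /\
    (forall i j x, app t i x -> plus k i j -> app u j x).
Proof.
  split.
  - intros (k & m & l & g & Hs & Ht & Hu & Hg & Hl & H1 & H2).
    assert (Hm : natural m) by apply Ht.
    exists k, m, l; repeat split; try apply Hs; try apply Ht; try apply Hu; auto.
    + apply (shift_plus g k m m l); auto.
    + intros i j x Hx Hj; apply H2 with i; auto.
      apply (shift_plus g k m i j); auto; left; now apply seq_dom with X t x.
  - intros (k & m & l & Hs & Ht & Hu & Hl & H1 & H2).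
    assert (Hm : natural m) by apply Ht.
    destruct (shift_exists k m Hm) as [g Hg].
    exists k, m, l, g; split; [|split; [|split; [|split; [|split; [|split]]]]]; auto.
    + apply (shift_plus g k m m l); auto.
    + intros i j x Hx Hj; apply H2 with i; auto.
      apply (shift_plus g k m i j); auto; left; now apply seq_dom with X t x.
Qed.

Lemma cat_lengths (X s t u k m : V) : is_cat X s t u -> seq X s k -> seq X t m ->
  exists l, seq X u l /\ plus k m l /\
    (forall i x, app s i x -> app u i x) /\
    (forall i j x, app t i x -> plus k i j -> app u j x).
Proof.
  intros H Hs Ht; apply cat_iff in H as (k' & m' & l & Hs' & Ht' & H).
  rewrite (seq_length X s k k'), (seq_length X t m m') by auto; now exists l.
Qed.

Lemma cat_finseq (X s t u : V) : is_cat X s t u -> finseq X s /\ finseq X t /\ finseq X u.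
Proof.
  intros (k & m & l & g & Hs & Ht & Hu & _); repeat split; eexists; eauto.
Qed.

Lemma cat_exists (X s t : V) : finseq X s -> finseq X t -> exists u, is_cat X s t u.
Proof.
  intros [k Hs] [m Ht].
  assert (Hk : natural k) by apply Hs; assert (Hm : natural m) by apply Ht.
  destruct (plus_total k m Hm) as [l Hl].
  destruct (function_by_graph l X
    (fun i x => app s i x \/ exists j, app t j x /\ plus k j i))
    as (u & Hu & Happ).
  - separable.
  - intros i Hi; destruct (plus_split k m Hm i l Hl Hi) as [Hik | (j & Hj & Hji)].
    + destruct (seq_total X s k i Hs Hik) as [x Hx]; exists x; split; auto.
      intros y [Hy | (j & Hy & Hj)]; [now apply seq_fun with X s k i|].
      exfalso; apply (plus_not_lt k j i); auto.
      apply (seq_index_natural X t m); auto; now apply seq_dom with X t y.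
    + destruct (seq_total X t m j Ht Hj) as [x Hx]; exists x; split; [eauto|].
      assert (Nj : natural j) by now apply (seq_index_natural X t m).
      intros y [Hy | (j' & Hy & Hj')].
      * exfalso; apply (plus_not_lt k j i); auto; now apply seq_dom with X s y.
      * assert (Hjm : j' ∈ m) by now apply seq_dom with X t y.
        assert (Nj' : natural j') by now apply (seq_index_natural X t m).
        rewrite (plus_inj k j' j i) in Hy by auto.
        now apply seq_fun with X t m j.
  - intros i x _ [Hx | (j & Hx & _)];
      [now apply seq_val with s k i | now apply seq_val with t m j].
  - exists u; apply cat_iff; exists k, m, l.
    split; auto; split; auto; split; [split; auto; now apply plus_natural with k m|].
    split; auto; split.
    + intros i x Hx; apply Happ; split; auto.
      assert (Hi : i ∈ k) by now apply seq_dom with X s x.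
      destruct (plus_ge k m Hm l Hl) as [H | <-]; auto.
      apply natural_trans with k; auto; now apply plus_natural with k m.
    + intros i j x Hx Hj; apply Happ; split; [|eauto].
      assert (Hi : i ∈ m) by now apply seq_dom with X t x.
      now apply (plus_lt k m Hk Hm i j l).
Qed.

Lemma cat_mono (X s t t' u u' : V) : is_cat X s t u -> is_cat X s t' u' -> t' ⊆ t -> u' ⊆ u.
Proof.
  intros Hu Hu' Hsub.
  destruct (cat_finseq X s t u Hu) as ([k Hs] & [m Ht] & _).
  destruct (cat_finseq X s t' u' Hu') as (_ & [m' Ht'] & _).
  destruct (cat_lengths X s t u k m Hu Hs Ht) as (l & Hul & _ & H1 & H2).
  destruct (cat_lengths X s t' u' k m' Hu' Hs Ht') as (l' & Hul' & Hl' & H1' & H2').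
  assert (Hsub' := proj1 (seq_subset X t' t m' m Ht' Ht) Hsub).
  apply (seq_subset X u' u l' l Hul' Hul); intros j x Hx.
  assert (Hj : j ∈ l') by now apply seq_dom with X u' x.
  assert (Hm' : natural m') by apply Ht'.
  destruct (plus_split k m' Hm' j l' Hl' Hj) as [Hjk | (i & Hi & Hij)].
  - destruct (seq_total X s k j Hs Hjk) as [y Hy].
    rewrite (seq_fun X u' l' j x y) by auto; auto.
  - destruct (seq_total X t' m' i Ht' Hi) as [y Hy].
    rewrite (seq_fun X u' l' j x y) by eauto; eauto.
Qed.

Lemma cat_unique (X s t u u' : V) : is_cat X s t u -> is_cat X s t u' -> u = u'.
Proof.
  intros Hu Hu'; apply ext; intros p; split.
  - now apply (cat_mono X s t t u' u).
  - now apply (cat_mono X s t t u u').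
Qed.

Lemma cat_assoc (X a b c ab bc w : V) :
  is_cat X a b ab -> is_cat X b c bc -> is_cat X ab c w -> is_cat X a bc w.
Proof.
  intros Hab Hbc Hw.
  destruct (cat_finseq X a b ab Hab) as ([k Ha] & [m Hb] & _).
  destruct (cat_finseq X b c bc Hbc) as (_ & [n Hc] & _).
  destruct (cat_lengths X a b ab k m Hab Ha Hb) as (km & Sab & Hkm & A1 & A2).
  destruct (cat_lengths X b c bc m n Hbc Hb Hc) as (mn & Sbc & Hmn & B1 & B2).
  destruct (cat_lengths X ab c w km n Hw Sab Hc) as (l & Sw & Hl & W1 & W2).
  assert (Hm : natural m) by apply Hb; assert (Hn : natural n) by apply Hc.
  apply cat_iff; exists k, mn, l.
  split; auto; split; auto; split; auto; split; [|split; auto].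
  - now apply (plus_assoc k m n Hm Hn km mn l).
  - intros i j x Hx Hj.
    assert (Hi : i ∈ mn) by now apply seq_dom with X bc x.
    destruct (plus_split m n Hn i mn Hmn Hi) as [Him | (i' & Hi' & Hmi)].
    + destruct (seq_total X b m i Hb Him) as [y Hy].
      rewrite (seq_fun X bc mn i x y) by auto; eauto.
    + destruct (seq_total X c n i' Hc Hi') as [y Hy].
      rewrite (seq_fun X bc mn i x y) by eauto.
      assert (Ni' : natural i') by now apply natural_elem with n.
      apply W2 with i'; auto.
      destruct (plus_total km i' Ni') as [j' Hj'].
      rewrite (plus_fun k i j j'); auto; [now apply natural_elem with mn; [apply Sbc|]|].
      now apply (plus_assoc k m i' Hm Ni' km i j').
Qed.

Lemma cat_assoc_rev (X a b c ab bc w : V) :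
  is_cat X a b ab -> is_cat X b c bc -> is_cat X a bc w -> is_cat X ab c w.
Proof.
  intros Hab Hbc Hw.
  destruct (cat_exists X ab c) as [w' Hw'];
    [apply (cat_finseq X a b ab Hab) | apply (cat_finseq X b c bc Hbc) |].
  rewrite (cat_unique X a bc w w'); auto; now apply cat_assoc with b c ab.
Qed.

Lemma empty_seq (X e : V) : is_empty e -> seq X e e.
Proof.
  intros He; split; [now apply natural_zero|]; split; [split|].
  - intros p Hp; now apply He in Hp.
  - intros p Hp; now apply He in Hp.
  - intros i x (p & _ & Hp); now apply He in Hp.
Qed.

Lemma empty_app (e i x : V) : is_empty e -> ~ app e i x.
Proof. intros He (p & _ & Hp); now apply He in Hp. Qed.

Lemma cat_empty_r (X s e : V) : is_empty e -> finseq X s -> is_cat X s e s.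
Proof.
  intros He [k Hs]; apply cat_iff; exists k, e, k.
  split; auto; split; [now apply empty_seq|]; split; auto.
  split; [now apply plus_zero|]; split; auto.
  intros i j x Hx; now apply empty_app in Hx.
Qed.

Lemma cat_empty_l (X e t : V) : is_empty e -> finseq X t -> is_cat X e t t.
Proof.
  intros He [m Ht]; assert (Hm : natural m) by apply Ht.
  apply cat_iff; exists e, m, m.
  split; [now apply empty_seq|]; split; auto; split; auto.
  split; [now apply plus_zero_l|]; split.
  - intros i x Hx; now apply empty_app in Hx.
  - intros i j x Hx Hj.
    assert (Ni : natural i).
    { apply (seq_index_natural X t m); auto; now apply seq_dom with X t x. }
    now rewrite (plus_fun e i j i) by auto using plus_zero_l.
Qed.

Lemma single_exists (x : V) : exists t, is_single x t.
Proof.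
  destruct empty_exists as [z Hz], (pair_exists z x) as [p Hp], (adjoin_exists z p) as [t Ht].
  exists t; intros q; rewrite Ht; split.
  - intros [Hq | ->]; [now apply Hz in Hq | now exists z].
  - intros (z' & Hz' & Hq); right; rewrite (empty_unique z' z) in Hq by auto.
    now apply pair_unique with z x.
Qed.

Lemma single_unique (x t t' : V) : is_single x t -> is_single x t' -> t = t'.
Proof. intros H H'; apply ext; intros p; rewrite (H p), (H' p); reflexivity. Qed.

Lemma single_app (x t i y : V) : is_single x t -> (app t i y <-> is_empty i /\ y = x).
Proof.
  intros Ht; split.
  - intros (p & Hp & H); apply Ht in H as (z & Hz & H).
    now destruct (pair_inj p i y z x Hp H) as [-> ->].
  - intros [Hi ->]; destruct (pair_exists i x) as [p Hp]; exists p; split; auto.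
    apply Ht; now exists i.
Qed.

Lemma single_seq (X x t z o : V) :
  is_single x t -> x ∈ X -> is_empty z -> is_succ o z -> seq X t o.
Proof.
  intros Ht Hx Hz Ho.
  assert (Hi : forall i, i ∈ o <-> is_empty i).
  { intros i; rewrite (Ho i); split.
    - intros [H | ->]; auto; now apply Hz in H.
    - intros H; right; now apply empty_unique. }
  split; [now apply natural_succ with z; [apply natural_zero|]|]; split; [split|].
  - intros p Hp; apply Ht in Hp as (z' & Hz' & Hp); exists z', x; rewrite Hi; auto.
  - intros i H; apply Hi in H; exists x; split.
    + now apply single_app with (i := i) (y := x) in Ht as ->.
    + intros y Hy; now apply (single_app x t i y Ht) in Hy as [_ ->].
  - intros i y Hy; now apply (single_app x t i y Ht) in Hy as [_ ->].
Qed.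

Lemma single_finseq (X x t : V) : is_single x t -> x ∈ X -> finseq X t.
Proof.
  intros Ht Hx; destruct empty_exists as [z Hz], (succ_exists z) as [o Ho].
  exists o; now apply single_seq with x z.
Qed.

Lemma snoc_exists (X t x : V) : finseq X t -> x ∈ X -> exists u, is_snoc X t x u.
Proof.
  intros Ht Hx; destruct (single_exists x) as [sx Hsx].
  destruct (cat_exists X t sx) as [u Hu]; auto; [now apply single_finseq with x|].
  now exists u, sx.
Qed.

Lemma snoc_cat (X t x u sx : V) : is_single x sx -> (is_snoc X t x u <-> is_cat X t sx u).
Proof.
  intros Hs; split; [|now exists sx].
  intros (sx' & Hs' & Hu); now rewrite (single_unique x sx sx').
Qed.

Lemma snoc_unique (X t x u u' : V) : is_snoc X t x u -> is_snoc X t x u' -> u = u'.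
Proof.
  intros (sx & Hsx & Hu) Hu'; apply (snoc_cat X t x u' sx Hsx) in Hu'.
  now apply cat_unique with X t sx.
Qed.

Lemma cat_snoc (X s t x st tx w : V) :
  is_cat X s t st -> is_snoc X t x tx -> (is_cat X s tx w <-> is_snoc X st x w).
Proof.
  intros Hst (sx & Hsx & Htx); rewrite (snoc_cat X st x w sx Hsx); split.
  - now apply cat_assoc_rev with t.
  - now apply cat_assoc with t.
Qed.

Lemma snoc_finseq (X t x u : V) : is_snoc X t x u -> finseq X t /\ finseq X u.
Proof. intros (sx & _ & Hu); apply cat_finseq in Hu; tauto. Qed.

Lemma snoc_seq (X t x u n : V) : is_snoc X t x u -> seq X t n ->
  exists n', is_succ n' n /\ seq X u n' /\ (forall i y, app t i y -> app u i y).
Proof.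
  intros (sx & Hsx & Hu) Ht.
  destruct empty_exists as [z Hz], (succ_exists z) as [o Ho], (succ_exists n) as [n' Hn'].
  destruct (cat_finseq X t sx u Hu) as (_ & [o' Ho'] & _).
  assert (Hz0 : app sx z x) by (apply (single_app x sx z x Hsx); auto).
  assert (So : seq X sx o).
  { apply single_seq with x z; auto; now apply seq_val with sx o' z. }
  destruct (cat_lengths X t sx u n o Hu Ht So) as (l & Hl & Hp & H1 & H2).
  exists n'; split; auto; split; auto.
  rewrite (plus_fun n o n' l); auto; [apply So|].
  apply plus_succ with z n; auto using natural_zero, plus_zero.
Qed.

(** This is what makes a tree condition on t⌢⟨x⟩ a condition on t and one new
    node. *)
Lemma snoc_initial (X t x u v : V) :
  is_snoc X t x u -> finseq X v -> v ⊆ u -> v = u \/ v ⊆ t.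
Proof.
  intros H [k Hv] Hvu; destruct (snoc_finseq X t x u H) as [[n Ht] _].
  destruct (snoc_seq X t x u n H Ht) as (n' & Hn' & Hu & Hsub).
  assert (Hvu' := proj1 (seq_subset X v u k n' Hv Hu) Hvu).
  assert (Nk : natural k) by apply Hv; assert (Nn' : natural n') by apply Hu.
  destruct (natural_total k Nk n' Nn') as [Hk | [-> | Hk]].
  - right; apply (seq_subset X v t k n); auto; intros i y Hy.
    assert (Hi : i ∈ n).
    { assert (Hi : i ∈ k) by now apply seq_dom with X v y.
      apply Hn' in Hk as [Hk | <-]; auto.
      apply natural_trans with k; auto; apply Ht. }
    destruct (seq_total X t n i Ht Hi) as [y' Hy'].
    now rewrite (seq_fun X u n' i y y') by auto.
  - left; now apply seq_eq_of_subset with X n'.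
  - exfalso; destruct (seq_total X v k n' Hv Hk) as [y Hy].
    apply (mem_irrefl n'), (seq_dom X u n' n' y Hu); auto.
Qed.

(** * Chains of extensions *)

Lemma extends_refl (X U p : V) : condition X U p -> extends X U p p.
Proof.
  intros Hp; destruct empty_exists as [z Hz], (succ_exists z) as [o Ho].
  assert (Hf : function_on z z).
  { split; intros x Hx; now apply Hz in Hx. }
  destruct (function_extend z z o z p Hf (Hz z) Ho) as (f & Hf' & Happ).
  split; auto; exists z, o, f, z.
  split; [now apply natural_zero|]; split; auto; split; auto; split; auto.
  split; [apply Happ; auto|]; split; [apply Happ; auto|].
  intros i i' a b Hi; now apply Hz in Hi.
Qed.

Lemma extends_step (X U p q r : V) : extends X U q p ->
  direct_ext X U r q \/ one_point_ext X U r q -> extends X U r p.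
Proof.
  intros (Hp & k & k' & f & z & Hk & Hk' & Hf & Hz & Hfz & Hfk & Hs) Hr.
  destruct (succ_exists k') as [k'' Hk''].
  destruct (function_extend f k' k'' k' r Hf (mem_irrefl k') Hk'') as (f' & Hf' & Happ).
  assert (Hold : forall i a, i ∈ k' -> app f' i a -> app f i a).
  { intros i a Hi Ha; apply Happ in Ha as [Ha | [-> _]]; auto.
    now apply mem_irrefl in Hi. }
  split; auto; exists k', k'', f', z.
  split; [now apply natural_succ with k|]; split; auto; split; auto; split; auto.
  split; [apply Happ; auto|]; split; [apply Happ; auto|].
  intros i i' a b Hi Hi' Ha Hb; apply Hold in Ha; auto.
  destruct (proj1 (Hk' i) Hi) as [Hik | ->].
  - apply Hs with i i'; auto; apply Hold; auto; now apply succ_lt with k i.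
  - rewrite (succ_unique k i' k') in Hb by auto.
    rewrite (app_fun f k' k a q Hf Ha Hfk).
    apply Happ in Hb as [Hb | [_ ->]]; auto.
    apply app_dom with (a := k') in Hb; auto; now apply mem_irrefl in Hb.
Qed.

(** Induction along the chain inside the model.  The separability premise is
    stated for the predicate to which the induction on indices is applied. *)
Lemma extends_induction (X U p q : V) (P : V -> Prop) :
  (forall f m, separable (fun i => i ∈ m -> forall a, app f i a -> P a)) ->
  P p ->
  (forall a b, P a -> direct_ext X U b a \/ one_point_ext X U b a -> P b) ->
  extends X U q p -> P q.
Proof.
  intros sep H0 HS (_ & k & k' & f & z & Hk & Hk' & Hf & Hz & Hfz & Hfk & Hs).
  assert (H : forall i, natural i -> i ∈ k' -> forall a, app f i a -> P a).
  { induct_natural; [apply sep| |].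
    - intros i Hi _ a Ha; rewrite (empty_unique i z) in Ha by auto.
      now rewrite (app_fun f k' z a p Hf Ha Hfz).
    - intros i i' Ni IH Hi' Hlt b Hb.
      assert (Hii' : i ∈ i') by now apply succ_self.
      assert (Hik : i ∈ k).
      { apply Hk' in Hlt as [Hlt | <-]; auto; now apply natural_trans with i'. }
      assert (Hik' : i ∈ k') by (apply Hk'; auto).
      destruct (app_total f k' i Hf Hik') as [a Ha].
      apply HS with a; eauto. }
  apply (H k); auto; now apply succ_self.
Qed.

(** * Ultrafilters and large trees *)

Lemma finseqs_exist (X : V) : exists F, forall s, s ∈ F <-> finseq X s.
Proof.
  destruct omega_exists as [w Hw], (product_exists w X) as [c Hc].
  pose proof zf as (_ & _ & _ & _ & pow & _); destruct (pow c) as [P HP].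
  assert (sep : separable (fun s => finseq X s)) by separable.
  destruct (sep P) as [F HF]; exists F; intros s; rewrite HF; split; [tauto|].
  intros Hs; split; auto; apply HP; intros p Hp; apply Hc.
  destruct Hs as [n Hs]; assert (Hs' := Hs); destruct Hs' as (Hn & [Hd _] & Hv).
  destruct (Hd p Hp) as (i & x & Hi & Hix); exists i, x; split; [|split; auto].
  - apply Hw; now apply natural_elem with n.
  - apply Hv with i; now exists p.
Qed.

Lemma subtree_exists (X T r : V) : exists T', is_subtree_at X T r T'.
Proof.
  destruct (finseqs_exist X) as [F HF].
  assert (sep : separable (fun t => exists u, is_cat X r t u /\ u ∈ T)) by separable.
  destruct (sep F) as [T' HT']; exists T'; intros t; rewrite HT'; split; [tauto|].
  intros H; split; auto; apply HF; destruct H as (u & Hu & _).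
  now apply cat_finseq in Hu.
Qed.

Section Forcing.
Context {X U : V} (hU : ultrafilter X U).

Lemma U_subset A : A ∈ U -> A ⊆ X.
Proof. apply hU. Qed.

Lemma U_nonempty A : A ∈ U -> exists x, x ∈ A.
Proof.
  destruct hU as (_ & _ & H & _); intros HA; apply NNPP; intros Hn.
  apply (H A HA); intros x Hx; eauto.
Qed.

Lemma U_up A B : A ∈ U -> A ⊆ B -> B ⊆ X -> B ∈ U.
Proof. apply hU. Qed.

Lemma U_inter A B : A ∈ U -> B ∈ U ->
  exists C, C ∈ U /\ forall x, x ∈ C <-> x ∈ A /\ x ∈ B.
Proof.
  destruct hU as (_ & _ & _ & _ & H & _); intros HA HB.
  assert (sep : separable (fun x => x ∈ B)) by separable.
  destruct (sep A) as [C HC]; exists C; split; auto; now apply (H A B).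
Qed.

Lemma U_dichotomy (P : V -> Prop) :
  separable P -> separable (fun x => ~ P x) ->
  (exists A, A ∈ U /\ forall x, x ∈ A <-> x ∈ X /\ P x) \/
  (exists A, A ∈ U /\ forall x, x ∈ A <-> x ∈ X /\ ~ P x).
Proof.
  intros sep sep'; destruct (sep X) as [A HA], (sep' X) as [B HB].
  destruct hU as (_ & _ & _ & _ & _ & H); destruct (H A B) as [HU | HU]; eauto.
  - intros x Hx; apply HA in Hx; tauto.
  - intros x; rewrite HB, HA; tauto.
Qed.

Lemma splits_mono S S' t : splits X U S t -> S ⊆ S' -> splits X U S' t.
Proof.
  intros (A & HA & H) Hsub; exists A; split; auto.
  intros x Hx; destruct (H x Hx) as (u & Hu & HS); exists u; auto.
Qed.

Lemma splits_inter S S' S'' t : splits X U S t -> splits X U S' t ->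
  (forall u, u ∈ S -> u ∈ S' -> u ∈ S'') -> splits X U S'' t.
Proof.
  intros (A & HA & H) (A' & HA' & H') Hsub.
  destruct (U_inter A A' HA HA') as (C & HC & HCi); exists C; split; auto.
  intros x Hx; apply HCi in Hx as [Hx Hx'].
  destruct (H x Hx) as (u & Hu & HS), (H' x Hx') as (u' & Hu' & HS').
  rewrite (snoc_unique X t x u' u) in HS' by auto; exists u; auto.
Qed.

Lemma large_tree_iff T : large_tree X U T <->
  tree X T /\ (exists e, is_empty e /\ e ∈ T) /\ forall t, t ∈ T -> splits X U T t.
Proof.
  split; intros (HT & He & Hs); split; auto; split; auto; intros t Ht.
  - destruct (Hs t Ht) as (A & HA & HU); exists A; split; auto.
    intros x Hx; now apply HA in Hx.
  - destruct (Hs t Ht) as (A & HA & HAx).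
    assert (sep : separable (fun x => exists u, is_snoc X t x u /\ u ∈ T)) by separable.
    destruct (sep X) as [B HB]; exists B; split; auto.
    apply (U_up A); auto.
    + intros x Hx; apply HB; split; auto; now apply (U_subset A).
    + intros x Hx; now apply HB in Hx.
Qed.

Lemma large_tree_empty T e : large_tree X U T -> is_empty e -> e ∈ T.
Proof. intros (_ & (e' & He' & H) & _) He; now rewrite (empty_unique e e'). Qed.

(** A splitting set of nodes need not be closed under initial segments; passing
    to the nodes all of whose initial segments belong to it repairs this, and
    the successors stay because t⌢⟨x⟩ has only itself as a new initial segment. *)
Lemma hereditary_part_large (B H : V) :
  (forall t, t ∈ B -> finseq X t) ->
  (exists e, is_empty e /\ e ∈ B) ->
  (forall t, t ∈ B -> splits X U B t) ->
  (forall t, t ∈ H <-> t ∈ B /\ forall u, finseq X u -> u ⊆ t -> u ∈ B) ->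
  large_tree X U H.
Proof.
  intros Hfin (e & He & HeB) Hs HH; apply large_tree_iff; split; [split|split].
  - intros t Ht; apply HH in Ht as [Ht _]; auto.
  - intros s t Ht Fs Hst; apply HH in Ht as [_ Ht]; apply HH; split; auto.
    intros u Fu Hu; apply Ht; auto; intros y Hy; auto.
  - exists e; split; auto; apply HH; split; auto.
    intros u _ Hu; rewrite (empty_unique u e); auto.
    intros x Hx; apply Hu in Hx; now apply He in Hx.
  - intros t Ht; apply HH in Ht as [HtB Ht].
    destruct (Hs t HtB) as (A & HA & HAx); exists A; split; auto.
    intros x Hx; destruct (HAx x Hx) as (u & Hu & HuB); exists u; split; auto.
    apply HH; split; auto; intros v Fv Hv.
    destruct (snoc_initial X t x u v Hu Fv Hv) as [-> | Hv']; auto.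
Qed.

Lemma large_tree_inter T T' H : large_tree X U T -> large_tree X U T' ->
  (forall t, t ∈ H <-> t ∈ T /\ t ∈ T') -> large_tree X U H.
Proof.
  intros HT HT' HH.
  apply large_tree_iff in HT as ([Hf Hc] & (e & He & HeT) & Hs).
  apply large_tree_iff in HT' as ([Hf' Hc'] & (e' & He' & HeT') & Hs').
  rewrite (empty_unique e' e) in HeT' by auto.
  apply large_tree_iff; split; [split|split].
  - intros t Ht; apply HH in Ht as [Ht _]; auto.
  - intros s t Ht Fs Hst; apply HH in Ht as [Ht Ht']; apply HH; eauto.
  - exists e; split; auto; apply HH; auto.
  - intros t Ht; apply HH in Ht as [Ht Ht'].
    apply (splits_inter T T'); auto; intros u; rewrite HH; auto.
Qed.

Lemma subtree_large T r T' : large_tree X U T -> r ∈ T ->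
  is_subtree_at X T r T' -> large_tree X U T'.
Proof.
  intros HT Hr HT'.
  apply large_tree_iff in HT as ([Hf Hc] & (e & He & HeT) & Hs).
  apply large_tree_iff; split; [split|split].
  - intros t Ht; apply HT' in Ht as (u & Hu & _); now apply cat_finseq in Hu.
  - intros s t Ht Fs Hst; apply HT' in Ht as (u & Hu & HuT); apply HT'.
    destruct (cat_exists X r s) as [w Hw]; auto; exists w; split; auto.
    apply Hc with u; auto; [now apply cat_finseq in Hw|].
    now apply (cat_mono X r t s u w).
  - exists e; split; auto; apply HT'; exists r; split; auto.
    apply cat_empty_r; auto.
  - intros t Ht; apply HT' in Ht as (u & Hu & HuT).
    destruct (Hs u HuT) as (A & HA & HAx); exists A; split; auto.
    intros x Hx; destruct (HAx x Hx) as (w & Hw & HwT).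
    destruct (snoc_exists X t x) as [tx Htx];
      [now apply cat_finseq in Hu | now apply (U_subset A) |].
    exists tx; split; auto; apply HT'; exists w; split; auto.
    now apply (cat_snoc X r t x u tx w).
Qed.

Lemma at_node_mono s T T' t r : at_node X s T t r -> T ⊆ T' -> at_node X s T' t r.
Proof.
  intros (st & R & Hr & Hst & Ht & HR) Hsub; exists st, R; repeat split; auto.
  intros v Hv; destruct (HR v Hv) as (w & Hw & HT); exists w; auto.
Qed.

Lemma at_node_direct s T t a b :
  at_node X s T t a -> direct_ext X U b a -> at_node X s T t b.
Proof.
  intros (st & R & Ha & Hst & Ht & HR) (s' & Tb & Ta & (Hb & _) & (Ha' & _) & Hsub).
  destruct (pair_inj a st R s' Ta) as [<- <-]; auto.
  exists st, Tb; repeat split; auto.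
Qed.

(** The bookkeeping behind a one-point extension is associativity:
    (s⌢t)⌢⟨x⟩ = s⌢(t⌢⟨x⟩) for the stem and t⌢(⟨x⟩⌢v) = (t⌢⟨x⟩)⌢v for the tree. *)
Lemma at_node_one_point s T t a b st R x sx stx R' :
  at_node X s T t a -> is_pair a st R -> is_single x sx -> sx ∈ R ->
  is_snoc X st x stx -> is_subtree_at X R sx R' -> is_pair b stx R' ->
  exists tx, is_snoc X t x tx /\ at_node X s T tx b.
Proof.
  intros (st' & R1 & Ha' & Hst & Ht & HR) Ha Hsx HsxR Hstx HR' Hb.
  destruct (pair_inj a st' R1 st R) as [-> ->]; auto.
  destruct (HR sx HsxR) as (tx & Htx & HtxT).
  assert (Hsn : is_snoc X t x tx) by now apply (snoc_cat X t x tx sx).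
  exists tx; split; auto; exists stx, R'; split; auto; split; [|split; auto].
  - now apply (cat_snoc X s t x st tx stx).
  - intros v Hv; apply HR' in Hv as (y & Hy & HyR).
    destruct (HR y HyR) as (w & Hw & HwT); exists w; split; auto.
    now apply (cat_assoc_rev X t sx v tx y w).
Qed.

Lemma at_node_extends s T p0 r : is_cond X U p0 s T -> extends X U r p0 ->
  exists t, at_node X s T t r.
Proof.
  intros (Hp0 & Hs & HT).
  apply (extends_induction X U p0 r (fun r => exists t, at_node X s T t r)).
  - separable.
  - destruct empty_exists as [e He]; exists e, s, T.
    split; auto; split; [now apply cat_empty_r|].
    split; [now apply large_tree_empty|].
    intros v Hv; exists v; split; auto; apply cat_empty_l; auto; now apply HT.
  - intros a b [t Ha] [Hb | Hb].
    + exists t; now apply at_node_direct with a.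
    + destruct Hb as (st & R & stx & R' & e & A & x & sx & (Ha' & _) & (Hb & _) &
        He & HA & Hx & Hsn & Hsx & HR').
      apply HA in Hx as (Hx & u & Hu & HuR).
      apply (snoc_cat X e x u sx Hsx) in Hu.
      rewrite (cat_unique X e sx u sx) in HuR; auto.
      * destruct (at_node_one_point s T t a b st R x sx stx R') as (tx & _ & H); eauto.
      * apply cat_empty_l; auto; now apply single_finseq with x.
Qed.


(** * Decided nodes and kernels *)

Lemma natural_upper_bound (a b : V) : natural a -> natural b ->
  exists c, natural c /\ (a ∈ c \/ a = c) /\ (b ∈ c \/ b = c).
Proof.
  intros Ha Hb; destruct (natural_total a Ha b Hb) as [H | [-> | H]].
  - exists b; auto.
  - exists b; auto.
  - exists a; auto.
Qed.

Lemma length_ge_mono t n n' : natural n' -> n ∈ n' \/ n = n' ->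
  length_ge X t n' -> length_ge X t n.
Proof.
  intros Nn' Hn (m & Hm & Hlt); exists m; split; auto.
  destruct Hn as [Hn | ->]; auto; right.
  destruct Hlt as [<- | Hlt]; auto.
  apply natural_trans with n'; auto; apply Hm.
Qed.

Lemma length_lt t n : seq X t n -> forall n', is_succ n' n -> ~ length_ge X t n'.
Proof.
  intros Ht n' Hn' (m & Hm & Hlt).
  rewrite (seq_length X t m n) in Hlt by auto.
  assert (Hnn : n ∈ n') by now apply succ_self.
  apply (mem_irrefl n); destruct Hlt as [E | Hlt]; [now rewrite E in Hnn|].
  apply natural_trans with n'; auto; apply Ht.
Qed.

Context (hsigma : sigma_complete U) {p s T D : V} (hp : is_cond X U p s T)
  (hD : dense_open_below X U p D).

Let p_pair : is_pair p s T := proj1 hp.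
Let T_large : large_tree X U T := proj2 (proj2 hp).

Lemma T_finseq t : t ∈ T -> finseq X t.
Proof. apply T_large. Qed.

Lemma T_splits t : t ∈ T -> splits X U T t.
Proof. pose proof T_large as H; apply large_tree_iff in H; apply H. Qed.

(** If (s⌢t, R) is in D, then so are its one-point extensions, and those exist
    for all x in succ_R(⟨⟩) ∈ U. *)
Lemma decided_splits t : decided X U p D s T t ->
  exists A, A ∈ U /\ forall x, x ∈ A ->
    exists tx, is_snoc X t x tx /\ tx ∈ T /\ decided X U p D s T tx.
Proof.
  intros (r & HrD & Hrp & Hr).
  destruct hD as (Hcond & _ & Hopen).
  destruct (Hcond r HrD) as (st & R & Hcr); assert (Hcr' := Hcr).
  destruct Hcr' as (Hpr & Fst & HR).
  assert (HR' := HR); destruct HR' as (_ & (e & He & HeR) & Hsucc).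
  destruct (Hsucc e HeR) as (A & HA & HAU); exists A; split; auto.
  intros x Hx; assert (Hx' := Hx); apply HA in Hx' as (HxX & u & Hu & HuR).
  destruct (single_exists x) as [sx Hsx].
  apply (snoc_cat X e x u sx Hsx) in Hu.
  rewrite (cat_unique X e sx u sx) in HuR; auto;
    [|apply cat_empty_l; auto; now apply single_finseq with x].
  destruct (snoc_exists X st x Fst HxX) as [stx Hstx].
  destruct (subtree_exists X R sx) as [R' HR'].
  destruct (pair_exists stx R') as [r' Hr'].
  destruct (at_node_one_point s T t r r' st R x sx stx R') as (tx & Htx & Hn); auto.
  assert (Hext : one_point_ext X U r' r).
  { exists st, R, stx, R', e, A, x, sx.
    split; auto; split; [|tauto].
    split; auto; split; [now apply snoc_finseq in Hstx | now apply (subtree_large R sx)]. }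
  exists tx; split; auto; split; [destruct Hn as (? & ? & _ & _ & H & _); auto|].
  exists r'; split; [|split; auto].
  - apply Hopen with r; auto; apply extends_step with r; auto; apply extends_refl; eexists; eauto.
  - apply extends_step with r; auto.
Qed.

(** The witness R need not lie inside T'_t; its intersection with T'_t is still
    large, and by openness still gives a condition in D. *)
Lemma decided_shrink t T' T't : decided X U p D s T t -> large_tree X U T' ->
  T' ⊆ T -> t ∈ T' -> is_subtree_at X T' t T't ->
  exists st qt R r, is_cat X s t st /\ is_pair qt st T't /\
    R ⊆ T't /\ is_pair r st R /\ direct_ext X U r qt /\ r ∈ D.
Proof.
  intros (r & HrD & Hrp & st & R & Hr & Hst & Ht & _) HT' Hsub HtT' HT't.
  destruct hD as (Hcond & _ & Hopen).
  destruct (Hcond r HrD) as (st' & R1 & Hcr); assert (Hcr' := Hcr).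
  destruct Hcr' as (Hpr & Fst & HR).
  destruct (pair_inj r st' R1 st R) as [-> ->]; auto; clear Hpr.
  assert (sep : separable (fun v => v ∈ T't)) by separable.
  destruct (sep R) as [R' HR'].
  destruct (pair_exists st T't) as [qt Hqt], (pair_exists st R') as [r' Hr'].
  assert (LT' : large_tree X U T't) by now apply (subtree_large T' t).
  assert (LR' : large_tree X U R') by now apply (large_tree_inter R T't).
  assert (HR'T : R' ⊆ T't) by (intros v Hv; now apply HR' in Hv).
  assert (HR'R : R' ⊆ R) by (intros v Hv; now apply HR' in Hv).
  exists st, qt, R', r'; split; auto; split; auto; split; auto; split; auto; split.
  - exists st, R', T't; split; [split|split; [split|]]; auto.
  - apply Hopen with r; auto; apply extends_step with r; [apply extends_refl; eexists; eauto|].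
    left; exists st, R', R; split; [split|split]; auto.
Qed.

(** By [decided_splits] the set of all decided nodes splits within itself, so it
    is one of the sets whose union is the kernel. *)
Lemma decided_in_kernel t z : is_empty z ->
  t ∈ T -> decided X U p D s T t -> in_kernel X U p D s T z t.
Proof.
  intros Hz HtT Ht.
  assert (sep : separable (fun u => decided X U p D s T u)) by separable.
  destruct (sep T) as [S HS]; exists S; split; [apply HS; auto|].
  split; [intros u Hu; now apply HS in Hu|]; split.
  - intros u Hu; apply HS in Hu as [_ Hu].
    destruct (decided_splits u Hu) as (A & HA & HAx); exists A; split; auto.
    intros x Hx; destruct (HAx x Hx) as (ux & Hux & HT & Hd).
    exists ux; split; auto; apply HS; auto.
  - intros u Hu _; now apply HS in Hu.
Qed.

Lemma in_kernel_mono t n n' : natural n' -> n ∈ n' \/ n = n' ->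
  in_kernel X U p D s T n t -> in_kernel X U p D s T n' t.
Proof.
  intros Nn' Hn (S & Ht & Hsub & Hs & Hd); exists S.
  split; auto; split; auto; split; auto.
  intros u Hu Hl; apply Hd; auto; now apply length_ge_mono with n'.
Qed.

(** Adding t to the kernel gives a set that still splits within itself.  Since t
    is shorter than n, it does not have to be decided. *)
Lemma in_kernel_lift t n A : t ∈ T -> ~ length_ge X t n -> A ∈ U ->
  (forall x, x ∈ A -> exists tx, is_snoc X t x tx /\ in_kernel X U p D s T n tx) ->
  in_kernel X U p D s T n t.
Proof.
  intros Ht Hlen HA HAx.
  assert (sep : separable (fun u => u = t \/ in_kernel X U p D s T n u)) by separable.
  destruct (sep T) as [S HS].
  assert (Hker : forall u, in_kernel X U p D s T n u -> u ∈ S).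
  { intros u Hu; apply HS; split; auto.
    destruct Hu as (S' & Hu & Hsub & _); auto. }
  exists S; split; [apply HS; auto|]; split; [intros u Hu; now apply HS in Hu|]; split.
  - intros u Hu; apply HS in Hu as [_ [-> | Hu]].
    + exists A; split; auto; intros x Hx; destruct (HAx x Hx) as (tx & Htx & H).
      exists tx; auto.
    + destruct Hu as (S' & Hu & Hsub & Hs & Hd).
      apply (splits_mono S'); auto; intros v Hv; apply Hker; exists S'; auto.
  - intros u Hu Hl; apply HS in Hu as [_ [-> | Hu]]; [contradiction|].
    destruct Hu as (S' & Hu & Hsub & Hs & Hd); auto.
Qed.

(** Suppose not.  Then for each n the set B_n of the x with t⌢⟨x⟩ outside the n-th
    kernel is in U: otherwise its complement is, and [in_kernel_lift] applies at
    some index at least n and greater than |t|.  The intersection of the B_n is in U and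
    disjoint from A. *)
Lemma in_kernel_of_successors t A : t ∈ T -> A ∈ U ->
  (forall x, x ∈ A -> exists tx, is_snoc X t x tx /\
     exists n, natural n /\ in_kernel X U p D s T n tx) ->
  exists n, natural n /\ in_kernel X U p D s T n t.
Proof.
  intros Ht HA HAx; apply NNPP; intros Hno.
  destruct (T_finseq t Ht) as [k Hk], (succ_exists k) as [k' Hk'].
  assert (Nk' : natural k') by (apply natural_succ with k; auto; apply Hk).
  pose (P n x := exists tx, is_snoc X t x tx /\ in_kernel X U p D s T n tx).
  assert (HB : forall n, natural n ->
    exists B, B ∈ U /\ forall x, x ∈ B <-> x ∈ X /\ ~ P n x).
  { intros n Nn; destruct (U_dichotomy (P n)) as [(C & HC & HCx) | HB]; auto;
      [subst P; separable | subst P; separable |].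
    exfalso; apply Hno.
    (* [k'] = |t| + 1, so a kernel with index at least [k'] imposes nothing on t *)
    destruct (natural_upper_bound n k' Nn Nk') as (n' & Nn' & Hn & Hkn).
    exists n'; split; auto; apply (in_kernel_lift t n' C); auto.
    - intros Hl; apply (length_lt t k Hk k' Hk'); now apply length_ge_mono with n'.
    - intros x Hx; apply HCx in Hx as (_ & tx & Htx & H); exists tx; split; auto.
      now apply in_kernel_mono with n. }
  destruct omega_exists as [w Hw].
  destruct (function_by_graph w U (fun n B => forall x, x ∈ B <-> x ∈ X /\ ~ P n x))
    as (f & Hf & Happ).
  { subst P; separable. }
  { intros n Hn; apply Hw in Hn; destruct (HB n Hn) as (B & HBU & HBx).
    exists B; split; auto; intros B' HB'; apply ext; intros x.
    now rewrite HBx, HB'. }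
  { intros n B Hn HBx; apply Hw in Hn; destruct (HB n Hn) as (B' & HBU & HBx').
    replace B with B'; auto; apply ext; intros x; now rewrite HBx, HBx'. }
  assert (sep : separable (fun x => forall n B, app f n B -> x ∈ B)) by separable.
  destruct (sep X) as [I HI].
  assert (HIU : I ∈ U).
  { apply (hsigma w f I Hw Hf); intros x; rewrite HI; split; [tauto|].
    intros H; split; auto.
    destruct empty_exists as [z Hz]; pose proof (natural_zero z Hz) as Nz.
    apply Hw in Nz; destruct (app_total f w z (proj1 Hf) Nz) as [B Hzb].
    specialize (H z B Hzb); apply Happ in Hzb as [_ HBx]; now apply HBx in H. }
  destruct (U_inter A I HA HIU) as (C & HC & HCx).
  destruct (U_nonempty C HC) as [x Hx]; apply HCx in Hx as [HxA HxI].
  destruct (HAx x HxA) as (tx & Htx & n & Nn & Hn).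
  apply HI in HxI as [_ HxI].
  destruct (app_total f w n (proj1 Hf)) as [B HnB]; [now apply Hw|].
  specialize (HxI n B HnB); apply Happ in HnB as [_ HBx].
  apply HBx in HxI as [_ HxI]; apply HxI; now exists tx.
Qed.

Lemma root_in_kernel e : is_empty e ->
  exists n, natural n /\ in_kernel X U p D s T n e.
Proof.
  intros He; apply NNPP; intros Hno.
  pose (P t := exists n, natural n /\ in_kernel X U p D s T n t).
  assert (sepP : separable (fun t => ~ P t)) by (subst P; separable).
  destruct (sepP T) as [B HB].
  assert (sepH : separable (fun t => forall u, finseq X u -> u ⊆ t -> u ∈ B)) by separable.
  destruct (sepH B) as [H HH].
  (* [B] is the set of nodes outside all kernels *)
  assert (HL : large_tree X U H).
  { apply (hereditary_part_large B H); auto.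
    - intros t Ht; apply T_finseq; now apply HB in Ht.
    - exists e; split; auto; apply HB; split; auto; now apply large_tree_empty.
    - intros t Ht; apply HB in Ht as [Ht HtP].
      destruct (U_dichotomy (fun x => exists tx, is_snoc X t x tx /\ P tx))
        as [(A & HA & HAx) | (A & HA & HAx)];
        [subst P; separable | subst P; separable | |].
      + exfalso; apply HtP, (in_kernel_of_successors t A); auto; intros x Hx; now apply HAx in Hx.
      + destruct (T_splits t Ht) as (A' & HA' & HAx').
        destruct (U_inter A A' HA HA') as (C & HC & HCx); exists C; split; auto.
        intros x Hx; apply HCx in Hx as [Hx Hx'].
        destruct (HAx' x Hx') as (tx & Htx & HtxT); exists tx; split; auto.
        apply HB; split; auto; intros Hp; apply HAx in Hx as [_ Hx]; eauto. }
  assert (HHT : H ⊆ T) by (intros t Ht; apply HH in Ht as [Ht _]; now apply HB in Ht).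
  destruct (pair_exists s H) as [p0 Hp0].
  assert (Hc0 : is_cond X U p0 s H) by exact (conj Hp0 (conj (proj1 (proj2 hp)) HL)).
  assert (Hdir : direct_ext X U p0 p) by now exists s, H, T.
  destruct hD as (_ & Hdense & _).
  assert (Hp0p : extends X U p0 p).
  { apply extends_step with p; auto; apply extends_refl; now exists s, T. }
  destruct (Hdense p0 Hp0p) as (r & Hr & HrD).
  assert (Hr' : (exists t, at_node X s H t r) /\ extends X U r p).
  { split; [now apply at_node_extends with p0|].
    apply (extends_induction X U p0 r (fun r => extends X U r p)); auto; [separable|].
    intros a b Ha Hb; now apply extends_step with a. }
  destruct Hr' as ([t Ht] & Hrp).
  assert (HtH : t ∈ H) by (destruct Ht as (? & ? & _ & _ & HtH & _); auto).
  apply HH in HtH as [HtB _]; apply HB in HtB as [HtT HtP].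
  apply HtP; exists e; split; [now apply natural_zero|].
  apply decided_in_kernel; auto; exists r; split; auto; split; auto.
  now apply at_node_mono with H.
Qed.

(** * The canonical choice *)

Lemma least_natural (P : V -> Prop) : separable P ->
  (exists n, natural n /\ P n) ->
  exists n, natural n /\ P n /\ forall m, m ∈ n -> ~ P m.
Proof.
  intros sep (n & Nn & Pn).
  destruct omega_exists as [w Hw], (sep w) as [b Hb].
  pose proof zf as (_ & found & _).
  destruct (found b) as (m & Hm & Hmin).
  { exists n; apply Hb; split; auto; now apply Hw. }
  apply Hb in Hm as [Nm Pm]; apply Hw in Nm; exists m; split; auto; split; auto.
  intros k Hk Pk; apply (Hmin k); split; auto; apply Hb; split; auto.
  apply Hw; now apply natural_elem with m.
Qed.

(** The requirements in [canonical_choice] leave no freedom: n is least, and T^q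
    is given by a membership criterion. *)
Lemma canonical_choice_exists : exists q n,
  forall q' n', canonical_choice X U p D q' n' <-> q' = q /\ n' = n.
Proof.
  destruct empty_exists as [e He].
  destruct (least_natural (fun n => in_kernel X U p D s T n e)) as (n & Nn & Hn & Hmin);
    [separable | now apply root_in_kernel |].
  assert (sep : separable (fun t => forall u, finseq X u -> u ⊆ t ->
    in_kernel X U p D s T n u)) by separable.
  destruct (sep T) as [Tq HTq], (pair_exists s Tq) as [q Hq].
  exists q, n; intros q' n'; split.
  - intros (s' & T' & e' & Tq' & Hp & He' & Nn' & Hn' & Hmin' & Hq' & HTq').
    destruct (pair_inj p s' T' s T) as [-> ->]; auto.
    rewrite (empty_unique e' e) in * by auto.
    assert (n' = n).
    { destruct (natural_total n Nn n' Nn') as [H | [H | H]]; auto; exfalso.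
      - exact (Hmin' n H Hn).
      - exact (Hmin n' H Hn'). }
    subst n'; split; auto.
    replace Tq' with Tq in Hq'; [now apply pair_unique with s Tq|].
    apply ext; intros t; rewrite HTq, HTq'; reflexivity.
  - intros [-> ->]; exists s, T, e, Tq; split; auto.
    repeat (split; auto).
Qed.

Lemma canonical_choice_decides q n :
  canonical_choice X U p D q n -> decides_by X U p D q n.
Proof.
  intros (s' & T' & e & Tq & Hp & He & Nn & Hn & _ & Hq & HTq).
  destruct (pair_inj p s' T' s T) as [-> ->]; auto.
  assert (sep : separable (fun t => in_kernel X U p D s T n t)) by separable.
  destruct (sep T) as [B HB].
  assert (Hsub : Tq ⊆ T) by (intros t Ht; now apply HTq in Ht).
  assert (HkB : forall u, in_kernel X U p D s T n u -> u ∈ B).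
  { intros u Hu; apply HB; split; auto; destruct Hu as (S & Hu & HS & _); auto. }
  assert (Hself : forall t, t ∈ Tq -> in_kernel X U p D s T n t).
  { intros t Ht; apply HTq in Ht as [HtT Ht]; apply Ht; [now apply T_finseq|].
    intros x Hx; auto. }
  assert (HL : large_tree X U Tq).
  { apply (hereditary_part_large B Tq).
    - intros t Ht; apply T_finseq; now apply HB in Ht.
    - exists e; auto.
    - intros t Ht; apply HB in Ht as [_ (S & Ht & HS & Hs & Hd)].
      apply (splits_mono S); auto; intros u Hu; apply HkB; exists S; auto.
    - intros t; split.
      + intros Ht; split; [apply HkB; auto|].
        intros u Fu Hu; apply HkB; apply HTq in Ht as [_ Ht]; auto.
      + intros [HtB Ht]; apply HTq; split; [now apply HB in HtB|].
        intros u Fu Hu; specialize (Ht u Fu Hu); now apply HB in Ht. }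
  split; auto; split.
  - exists s, Tq, T; split; [exact (conj Hq (conj (proj1 (proj2 hp)) HL)) | split; auto].
  - exists s, Tq; split; auto; intros t Ht Hl.
    destruct (Hself t Ht) as (S & HtS & HS & Hs & Hd).
    destruct (subtree_exists X Tq t) as [Tqt HTqt].
    destruct (decided_shrink t Tq Tqt) as (st & qt & R & r & H); auto.
    exists st, Tqt, qt, R, r; tauto.
Qed.

End Forcing.
End Model.

(* [phi] defines the assignment (p, D) ↦ (q, n) from the parameter U, uniformly
   in all models of ZF; its free variables 0, ..., 4 stand for U, p, D, q, n. *)
Theorem lemma23 :
  exists phi : formula,
  forall V : set_structure, ZF V ->
  forall X U : V, ultrafilter X U -> sigma_complete U ->
  forall p D : V, condition X U p -> dense_open_below X U p D ->
  exists q n : V,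
    (forall (rho : nat -> V) (q' n' : V),
       sat V (U .: p .: D .: q' .: n' .: rho) phi <-> q' = q /\ n' = n) /\
    decides_by X U p D q n.
Proof.
  (* X is not among the free variables, but it is the largest element of U *)
  assert (Hdef : definable (fun V rho => exists X,
    (X ∈ rho 0 /\ forall A, A ∈ rho 0 -> A ⊆ X) /\
    canonical_choice X (rho 0) (rho 1) (rho 2) (rho 3) (rho 4))) by definable.
  destruct Hdef as [phi Hphi]; exists phi.
  intros V zf X U hU hsigma p D (s & T & hp) hD.
  destruct (canonical_choice_exists zf hU hsigma hp hD) as (q & n & Hqn).
  exists q, n; split.
  - intros rho q' n'; rewrite (Hphi V (U .: p .: D .: q' .: n' .: rho)), <- Hqn; simpl.
    split; [|intros H; exists X; split; auto; split; apply hU].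
    intros (X' & [HX' Hmax] & H); replace X with X'; auto.
    apply (ext zf); intros x; split; [apply hU; auto | apply Hmax, hU].
  - apply (canonical_choice_decides zf hU hp hD), Hqn; auto.
Qed.
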